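(* One-tape infinite time Turing machines (augmented with an oracle tape) give rise to the same relation of relative computability $A\le_\infty B$ and the same relation of computable equivalence $A\equiv_\infty B$ as the ordinary (three-tape) infinite time Turing machines, for oracles $A,B$ that are reals or sets of reals.
   Context: $\mathbb{R}=2^\omega$. An infinite time Turing machine (ITTM) has three tapes (input, scratch, output) of cells indexed by $\omega$ with values in $\{0,1\}$, one head, finitely many states including start, halt and a limit state; successor steps are as for ordinary Turing machines (moving left from the leftmost cell leaves the head in place); at limit stages the head returns to the leftmost cell, the state becomes the limit state, and each cell takes the $\limsup$ of its earlier values; output is the output tape upon halting. A one-tape ITTM has a single tape holding the input initially and whose whole contents are the output upon halting. Oracle machines (of either kind) have an additional oracle tape: for a real oracle $B$, the oracle tape contains $B$ and can be read; for an oracle $B\subseteq\mathbb{R}$, the oracle tape starts blank, the machine may write on it and may query whether the real currently on the oracle tape belongs to $B$, receiving the answer via its state. For $A,B$ reals or sets of reals, $A\le_\infty B$ means that the characteristic function of $A$ is computable by an oracle machine with oracle $B$; $A\equiv_\infty B$ means $A\le_\infty B$ and $B\le_\infty A$. The one-tape versions of these relations are defined using one-tape oracle machines. *)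

(* Defs.v *)
From mathcomp Require Import all_boot.
Set Implicit Arguments. Unset Strict Implicit. Unset Printing Implicit Defensive.

Definition real := nat -> bool.

Inductive oracle : Type :=
| OReal of real
| OSet of (real -> Prop).

(** An oracle ITTM with [k] work tapes (k = 3: input/scratch/output;
    k = 1: the single tape of a one-tape machine) plus an oracle tape, all
    scanned by one head.  States are ['I_(nst+5).+1] (finitely many), with
    distinguished states:  0 = start, 1 = halt, 2 = limit, 3 = query,
    4 = answer "yes", 5 = answer "no".
    [delta s r o = (s', w, ow, mv)]: in state [s] reading bits [r] on the work
    tapes and [o] on the oracle tape, go to state [s'], write [w] on the work
    tapes, write [ow] on the oracle tape (only effective for set oracles; the
    oracle tape of a real oracle is read-only), move right if [mv] else left. *)
Record prog (k : nat) := Prog {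
  nst : nat;
  delta : 'I_(nst + 5).+1 -> ('I_k -> bool) -> bool ->
          'I_(nst + 5).+1 * ('I_k -> bool) * bool * bool }.

Arguments delta {k} p _ _ _.
Arguments nst {k} p.

Record config (k n : nat) := Config {
  cst : 'I_(n + 5).+1;
  chead : nat;
  ctapes : 'I_k -> real;
  cotape : real }.

(** [orc_ans O x b]: [b] is the answer to querying whether the real [x]
    currently on the oracle tape belongs to the oracle set.  (For real oracles
    the query mechanism is unused; it answers "no".) *)
Definition orc_ans (O : oracle) (x : real) (b : bool) : Prop :=
  match O with
  | OReal _ => b = false
  | OSet Sb => (b = true <-> Sb x)
  end.

Arguments orc_ans : clear implicits.

(** One successor step, given the oracle answer [ans] (used only in the query
    state).  Moving left from cell 0 leaves the head in place ([0.-1 = 0]). *)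
Definition step k (P : prog k) (O : oracle) (ans : bool)
    (c : config k (nst P)) : config k (nst P) :=
  if (cst c : nat) == 3 then
    Config (inord (if ans then 4 else 5)) (chead c) (ctapes c) (cotape c)
  else
    let: (s', w, ow, mv) :=
       delta P (cst c) (fun i => ctapes c i (chead c)) (cotape c (chead c)) in
    Config s' (if mv then (chead c).+1 else (chead c).-1)
      (fun i m => if m == chead c then w i else ctapes c i m)
      (match O with
       | OReal _ => cotape c
       | OSet _ => fun m => if m == chead c then ow else cotape c m
       end).

Arguments step {k} P O ans c.

(** [c] is the limit configuration at stage [j] of the run [f] indexed by the
    well-order [lt]: limit state, head at cell 0, each cell the limsup
    (= 1 iff cofinally often 1 below [j]) of its earlier values. *)
Definition is_limit k n (I : Type) (lt : I -> I -> Prop) (f : I -> config k n)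
    (j : I) (c : config k n) : Prop :=
  (cst c : nat) = 2 /\ chead c = 0 /\
  (forall t m, ctapes c t m = true <->
     (forall i, lt i j -> exists i', ~ lt i' i /\ lt i' j /\ ctapes (f i') t m = true)) /\
  (forall m, cotape c m = true <->
     (forall i, lt i j -> exists i', ~ lt i' i /\ lt i' j /\ cotape (f i') m = true)).

Arguments is_limit {k n I} lt f j c.

(** [halts_from P O c0 cf]: the computation of [P] with oracle [O] starting in
    configuration [c0] halts, with halting configuration [cf].  A computation is
    a sequence of configurations indexed by a well-order (i.e. by an ordinal,
    up to isomorphism) starting at [c0], following the successor and limit rules,
    whose last stage is in the halt state. *)
Definition halts_from k (P : prog k) (O : oracle) (c0 cf : config k (nst P)) : Prop :=
  exists (I : Type) (lt : I -> I -> Prop) (f : I -> config k (nst P)),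
    well_founded lt /\
    (forall i j l, lt i j -> lt j l -> lt i l) /\
    (forall i j, lt i j \/ i = j \/ lt j i) /\
    (exists i0, (forall i, ~ lt i i0) /\ f i0 = c0) /\
    (forall i j, lt i j -> (forall l, ~ (lt i l /\ lt l j)) ->
       (cst (f i) : nat) <> 1 /\
       exists b, orc_ans O (cotape (f i)) b /\ f j = step P O b (f i)) /\
    (forall j, (exists i, lt i j) -> (forall i, lt i j -> exists l, lt i l /\ lt l j) ->
       is_limit lt f j (f j)) /\
    (exists ih, (cst (f ih) : nat) = 1 /\ (forall j, ~ lt ih j) /\ f ih = cf).

Arguments halts_from {k} P O c0 cf.

Definition init k (P : prog k) (O : oracle) (tin : 'I_k) (x : real) : config k (nst P) :=
  Config (inord 0) 0 (fun t => if t == tin then x else (fun _ => false))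
    (match O with OReal b => b | OSet _ => fun _ => false end).

Arguments init {k} P O tin x.

Definition enc (b : bool) : real := fun m => (m == 0) && b.

Definition nat_real (n : nat) : real := fun m => m == n.

Definition computes_char k (P : prog k) (tin tout : 'I_k) (O A : oracle) : Prop :=
  match A with
  | OReal a => forall n, exists cf,
      halts_from P O (init P O tin (nat_real n)) cf /\ ctapes cf tout = enc (a n)
  | OSet Sb => forall x, exists cf b,
      halts_from P O (init P O tin x) cf /\ ctapes cf tout = enc b /\ (b = true <-> Sb x)
  end.

Arguments computes_char {k} P tin tout O A.

Definition le_inf (A B : oracle) : Prop :=
  exists P : prog 3, computes_char P (inord 0) (inord 2) B A.
Definition eqv_inf (A B : oracle) : Prop := le_inf A B /\ le_inf B A.

Definition le_inf1 (A B : oracle) : Prop :=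
  exists P : prog 1, computes_char P ord0 ord0 B A.
Definition eqv_inf1 (A B : oracle) : Prop := le_inf1 A B /\ le_inf1 B A.

(* Main.v *)
Require Import Defs.
From HB Require Import structures.
From mathcomp Require Import all_boot.
From mathcomp Require Import zify.
From Stdlib Require Import Classical ClassicalEpsilon FunctionalExtensionality.
From Stdlib Require Import Relation_Operators Lexicographic_Product Inverse_Image.

(** A three-tape machine simulates a one-tape machine by writing on all its tapes.
    Conversely, the single tape is cut into blocks of seven cells
    [g x h d1 d2 a b]: block [r] holds cell [r] of the three simulated tapes in
    [x], [d1], [d2].  There is one head for the work tape and the oracle tape, so
    simulating a step with the head on cell [p] needs access both to block [p] and
    to the oracle cell [p], which lies at offset [p mod 7] of block [p / 7].  The
    positions are marked by a 0 in the tracks [a] and [b] of these two blocks; the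
    offset is recovered by walking left from block [p] to block 0, the only one
    with [g = 0].  Every simulated step temporarily lifts both marks, so a limsup
    restores both tracks to 1 at each simulated limit, and no bookkeeping survives.

    The input is first stretched, one block per round of [omega] steps, by shifting
    the rest of the tape to the right.  Each round flashes the [a] cell of block 0,
    which is therefore 1 at stage [omega ^ 2] but 0 at the earlier limits.  The [b]
    cell of block 0 is 0 in this phase and 1 at simulated limits.  When the simulated
    machine halts, the tape is erased up to the output bit, and [h = 0] in block 0
    tells the last limit from all others. *)

Set Implicit Arguments.
Unset Strict Implicit.
Unset Printing Implicit Defensive.

(** * Choice and well-orders *)

Lemma fun_choice A B (R : A -> B -> Prop) :
  (forall a, exists b, R a b) -> exists f, forall a, R a (f a).
Proof.
move=> h; exists (fun a => proj1_sig (constructive_indefinite_description _ (h a))) => a.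
exact: proj2_sig (constructive_indefinite_description _ (h a)).
Qed.
Record wellorder (J : Type) (lt : J -> J -> Prop) : Prop := WellOrder {
  wo_wf : well_founded lt;
  wo_trans : forall i j l, lt i j -> lt j l -> lt i l;
  wo_total : forall i j, lt i j \/ i = j \/ lt j i }.

Lemma wo_irrefl J (lt : J -> J -> Prop) : well_founded lt -> forall i, ~ lt i i.
Proof. by move=> wf i; elim/(well_founded_ind wf): i => i IH lii; apply: (IH i). Qed.

Lemma wo_min J (lt : J -> J -> Prop) (A : J -> Prop) : well_founded lt ->
  (exists j, A j) -> exists m, A m /\ forall i, lt i m -> ~ A i.
Proof.
move=> wf [j]; elim/(well_founded_ind wf): j => j IH Aj.
case: (classic (exists i, lt i j /\ A i)) => [[i [ij Ai]]|no]; first exact: IH Ai.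
by exists j; split=> // i ij Ai; apply: no; exists i.
Qed.

(** * Runs *)

(* [(true, m)] is cell [m] of the work tape, [(false, m)] that of the oracle tape. *)
Definition cell := (bool * nat)%type.

Definition cellv n (c : config 1 n) (z : cell) : bool :=
  if z.1 then ctapes c ord0 z.2 else cotape c z.2.

(** The relation [V] is kept abstract for two uses: [V i] is the set of cells holding 1 at stage
    [i], or, when runs are concatenated, the set of cells holding 1 somewhere in piece [i]. *)
Definition limit_of n J (lt : J -> J -> Prop) (D : J -> Prop)
    (V : J -> cell -> Prop) (c : config 1 n) : Prop :=
  (cst c : nat) = 2 /\ chead c = 0 /\
  forall z, cellv c z <-> (forall i, D i -> exists i', ~ lt i' i /\ D i' /\ V i' z).

(* [c] continues a sequence after its initial segment [D]: [last] relates the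
   last index of [D] to [c], and if there is none [c] is a limit configuration. *)
Definition continues n J (lt : J -> J -> Prop) (D : J -> Prop)
    (last : J -> config 1 n -> Prop) (V : J -> cell -> Prop) (c : config 1 n) :=
  (exists m, D m /\ (forall i, D i -> ~ lt m i) /\ last m c) \/
  ((exists i, D i) /\ (forall i, D i -> exists l, D l /\ lt i l) /\ limit_of lt D V c).

Lemma eq_next n J (lt : J -> J -> Prop) (D D' : J -> Prop) last V (c : config 1 n) :
  (forall i, D i <-> D' i) -> continues lt D last V c -> continues lt D' last V c.
Proof.
move=> eqD [[m [Dm [mx lm]]]|[[i Di] [nomax [s2 [h0 lim]]]]].
  by left; exists m; split; [apply/eqD|split=> // i /eqD; apply: mx].
right; split; first by exists i; apply/eqD.
split=> [j /eqD/nomax [l [/eqD Dl jl]]|]; first by exists l.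
split=> //; split=> // z; split=> [/lim h j /eqD/h [i' [a [/eqD b d]]]|h].
  by exists i'.
by apply/lim => j /eqD/h [i' [a [/eqD b d]]]; exists i'.
Qed.

Section Runs.
Variables (P : prog 1) (O : oracle).
Notation conf := (config 1 (nst P)).

Definition nstep (c c' : conf) : Prop :=
  (cst c : nat) <> 1 /\ exists b, orc_ans O (cotape c) b /\ c' = step P O b c.

Definition continues_conf J (lt : J -> J -> Prop) (f : J -> conf) (D : J -> Prop) : conf -> Prop :=
  continues lt D (fun i => nstep (f i)) (fun i z => cellv (f i) z).

(* The end configuration [c'] is not indexed by the run: runs are half-open. *)
Definition is_run J (lt : J -> J -> Prop) (f : J -> conf) (U : cell -> Prop) (c c' : conf) :=
  [/\ wellorder lt, exists i0, (forall i, ~ lt i i0) /\ f i0 = c,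
      forall j, (exists i, lt i j) -> continues_conf lt f (fun i => lt i j) (f j),
      continues_conf lt f (fun=> True) c' &
      forall z, U z <-> exists i, cellv (f i) z].

Record trace := Trace { pidx : Type; plt : pidx -> pidx -> Prop; pconf : pidx -> conf }.

(** The set [U] records exactly the cells that are 1 at some stage. These sets alone determine the
    limsup of a sequence of runs without a last member, so concatenations can be treated without
    looking inside the pieces. *)
Definition run (U : cell -> Prop) (c c' : conf) :=
  exists p : trace, is_run (@plt p) (@pconf p) U c c'.

(** * Concatenation of runs along a well-order *)

Section Sum.
Variables (K : Type) (lt : K -> K -> Prop) (c d : K -> conf) (U : K -> cell -> Prop).
Hypothesis ltW : wellorder lt.
Variable p : K -> trace.
Hypothesis pP : forall k, is_run (@plt (p k)) (@pconf (p k)) (U k) (c k) (d k).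

Let X := {k : K & pidx (p k)}.
Let ltJ k := @plt (p k).
Let F (x : X) : conf := pconf (projT2 x).
Let lx : X -> X -> Prop := lexprod K (fun k => pidx (p k)) lt ltJ.
Let ex k (a : pidx (p k)) : X := existT _ k a.

Let wfK := wo_wf ltW.
Let J_wo k : wellorder (ltJ (k := k)).
Proof. by case: (pP k). Qed.

Let lx_inv x y : lx x y -> lt (projT1 x) (projT1 y) \/
  exists e : projT1 x = projT1 y, ltJ (eq_rect _ (fun k => pidx (p k)) (projT2 x) _ e) (projT2 y).
Proof. by case=> [k a k' b h|k a b h]; [left|right; exists erefl]. Qed.

Let lx_same k (a b : pidx (p k)) : lx (ex a) (ex b) <-> ltJ a b.
Proof.
split=> [/lx_inv /= [/(wo_irrefl wfK)//|[e]]|]; last exact: right_lex.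
by rewrite (proof_irrelevance _ e erefl).
Qed.

Let lx_fst x y : lx x y -> ~ lt (projT1 y) (projT1 x).
Proof.
move=> /lx_inv [h h'|[e _]]; first exact: (wo_irrefl wfK (wo_trans ltW h h')).
by rewrite e; apply: wo_irrefl.
Qed.

Let lx_lt x y : lt (projT1 x) (projT1 y) -> lx x y.
Proof. by case: x y => [k a] [k' b] /=; apply: left_lex. Qed.

Let lx_wo : wellorder lx.
Proof.
split.
- by apply: wf_lexprod => [|k]; [exact: wfK|exact: (wo_wf (J_wo k))].
- move=> [k a] [k' b] [k'' e] /lx_inv /= [h1|[e1 h1]] /lx_inv /= [h2|[e2 h2]].
  + exact/lx_lt/(wo_trans ltW h1 h2).
  + by apply: lx_lt; rewrite /= -e2.
  + by apply: lx_lt; rewrite /= e1.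
  by destruct e1; destruct e2; apply/lx_same/(wo_trans (J_wo _) h1 h2).
- move=> [k a] [k' b]; case: (wo_total ltW k k') => [h|[e|h]].
  + by left; apply: lx_lt.
  + destruct e; case: (wo_total (J_wo k) a b) => [h|[->|h]].
    * by left; apply/lx_same.
    * by right; left.
    * by right; right; apply/lx_same.
  + by right; right; apply: lx_lt.
Qed.

(** All earlier pieces precede every stage of piece [k], so prepending them to a nonempty initial
    segment [D] of it changes neither the last stage nor a limsup. *)
Let sum_tail k (D : pidx (p k) -> Prop) e :
  (exists a, D a) -> continues_conf (ltJ (k := k)) (@pconf (p k)) D e ->
  continues_conf lx F (fun x => lt (projT1 x) k \/ exists a, x = ex a /\ D a) e.
Proof.
move=> [a0 Da0] [[m [Dm [mx lm]]]|[_ [nomax [s2 [h0 lim]]]]].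
  left; exists (ex m); split; first by right; exists m.
  split=> // x [h /lx_fst //|[a [-> Da]]] /lx_same; exact: mx.
right; split; first by exists (ex a0); right; exists a0.
split.
  move=> x [h|[a [-> Da]]].
    by exists (ex a0); split; [right; exists a0|apply: lx_lt].
  have [l [Dl al]] := nomax _ Da.
  by exists (ex l); split; [right; exists l|apply/lx_same].
split=> //; split=> // z; split.
  move=> /lim h x [xk|[a [-> Da]]].
    have [i [_ [Di Vi]]] := h _ Da0.
    by exists (ex i); split; [move/lx_fst|split=> //; right; exists i].
  have [i [ni [Di Vi]]] := h _ Da.
  by exists (ex i); split; [move/lx_same|split=> //; right; exists i].
move=> h; apply/lim => a Da.
have [|x [nx [Dx Vx]]] := h (ex a); first by right; exists a.
case: Dx => [xk|[b [eb Db]]]; first by case: nx; apply: lx_lt.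
by subst x; exists b; split=> // ba; apply: nx; apply/lx_same.
Qed.

(** If there is a last piece [m], the continuation is the end of that piece. Otherwise a cell is 1
    at cofinally many stages iff it lies in [U k] for cofinally many [k]. *)
Let sum_next (D : K -> Prop) e : (forall k k', lt k k' -> D k' -> D k) ->
  continues lt D (fun m c' => c' = d m) U e -> continues_conf lx F (fun x => D (projT1 x)) e.
Proof.
move=> dc [[m [Dm [mx ->]]]|[[k Dk] [nomax [s2 [h0 lim]]]]].
  case: (pP m) => _ [i0 _] _ nx _.
  apply: eq_next (sum_tail _ nx); last by exists i0.
  move=> [k a] /=; split=> [[h|[b [eb _]]]|Dk].
  - exact: dc h Dm.
  - by have -> : k = m by exact: (f_equal (fun x : X => projT1 x) eb).
  - case: (wo_total ltW k m) => [h|[h|/mx//]]; first by left.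
    by right; destruct h; exists a.
have ne k' : exists a : pidx (p k'), True by case: (pP k') => _ [i0 _] _ _ _; exists i0.
right; split; first by have [a _] := ne k; exists (ex a).
split.
  move=> [k' a] /= /nomax [l [Dl kl]]; have [b _] := ne l.
  by exists (ex b); split=> //; apply: lx_lt.
split=> //; split=> // z; split.
  move=> /lim h x /nomax [l [Dl xl]]; have [i [il [Di Vi]]] := h _ Dl.
  case: (pP i) => _ _ _ _ /(_ z) [/(_ Vi) [a Va] _].
  exists (ex a); split=> // /lx_fst ia.
  suff : lt (projT1 x) i by [].
  by case: (wo_total ltW l i) => [h'|[<- //|//]]; apply: (wo_trans ltW xl).
move=> h; apply/lim => i Di; have [a _] := ne i.
have [|[k' b] [nx [Dx Vx]]] := h (ex a); first by [].
exists k'; split; first by move=> h'; apply: nx; apply: lx_lt.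
by split=> //; case: (pP k') => _ _ _ _ /(_ z) [_]; apply; exists b.
Qed.

(** The pieces are glued along the lexicographic sum of their index orders. A stage with a
    predecessor in its own piece obeys the rules by [sum_tail], and the first stage of a piece by
    [sum_next]. *)
Lemma run_sum_trace k0 e : (forall k, ~ lt k k0) ->
  (forall k, (exists i, lt i k) -> continues lt (fun i => lt i k) (fun m c' => c' = d m) U (c k)) ->
  continues lt (fun=> True) (fun m c' => c' = d m) U e ->
  run (fun z => exists k, U k z) (c k0) e.
Proof.
move=> k0min nxt nxe; exists (@Trace X lx F); split=> /=.
- exact: lx_wo.
- case: (pP k0) => _ [i0 [i0min fi0]] _ _ _.
  exists (ex i0); split=> // [[k a]] /lx_inv /= [/k0min //|[h]].
  by destruct h; apply: i0min.
- move=> [k a] [y yka].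
  case: (classic (exists b, ltJ b a)) => [ab|amin].
    case: (pP k) => _ _ /(_ a ab) nx _ _.
    apply: eq_next (sum_tail ab nx) => x; split.
      by case=> [h|[b [-> h]]]; [apply: lx_lt|apply/lx_same].
    case: x => [k' b] /lx_inv /= [h|[h h']]; first by left.
    by right; destruct h; exists b.
  case: (pP k) => wo [i0 [i0min fi0]] _ _ _.
  have e0 : a = i0.
    case: (wo_total (J_wo k) a i0) => [/i0min//|[//|h]].
    by case: amin; exists i0.
  have yk : lt (projT1 y) k.
    case: y yka => [k' b] /lx_inv /= [//|[h h']].
    by destruct h; case: amin; exists b.
  rewrite /F /= e0 fi0.
  apply: eq_next (sum_next (e := c k) _ (nxt k _)).
  + move=> x; split=> [h|]; first exact: lx_lt.
    case: x => [k' b] /lx_inv /= [//|[h h']].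
    by exfalso; destruct h; apply: (i0min b).
  + by move=> i j ij jk; apply: (wo_trans ltW ij jk).
  + by exists (projT1 y).
- by apply: sum_next nxe.
- move=> z; split.
    move=> [k]; case: (pP k) => _ _ _ _ /(_ z) [h _] /h [a Va].
    by exists (ex a).
  move=> [[k a] Va]; exists k; case: (pP k) => _ _ _ _ /(_ z) [_]; apply.
  by exists a.
Qed.

End Sum.

Lemma run_sum K (lt : K -> K -> Prop) (c d : K -> conf) U k0 e :
  wellorder lt -> (forall k, run (U k) (c k) (d k)) -> (forall k, ~ lt k k0) ->
  (forall k, (exists i, lt i k) -> continues lt (fun i => lt i k) (fun m c' => c' = d m) U (c k)) ->
  continues lt (fun=> True) (fun m c' => c' = d m) U e ->
  run (fun z => exists k, U k z) (c k0) e.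
Proof.
move=> wo rs.
have [p pP] := fun_choice rs.
exact: (run_sum_trace wo pP).
Qed.

Lemma run_ext (U U' : cell -> Prop) c c' : (forall z, U z <-> U' z) -> run U c c' -> run U' c c'.
Proof. by move=> e [p [h1 h2 h3 h4 h5]]; exists p; split=> // z; rewrite -e. Qed.

Lemma run_step c c' : nstep c c' -> run (fun z => cellv c z) c c'.
Proof.
move=> st; exists (@Trace unit (fun _ _ => False) (fun=> c)); split=> /=.
- by split; [move=> j; split|move=> ? ? ? []|case; case; right; left].
- by exists tt; split=> // i [].
- by move=> j [].
- by left; exists tt; split=> //; split=> // i _ [].
- by move=> z; split=> [h|[]//]; exists tt.
Qed.

Lemma run_trans U1 U2 c1 c2 c3 : run U1 c1 c2 -> run U2 c2 c3 ->
  run (fun z => U1 z \/ U2 z) c1 c3.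
Proof.
move=> r1 r2.
pose lt (a b : bool) : Prop := ~~ a && b.
have wo : wellorder lt.
  split; last 2 first.
  - by case=> [] [] [].
  - by case=> [] []; [right; left|right; right|left|right; left].
  have af : Acc lt false by apply: Acc_intro => -[].
  by case; [apply: Acc_intro => -[h|_]; [discriminate h|exact: af]|exact: af].
have := @run_sum bool lt (fun b => if b then c2 else c1) (fun b => if b then c3 else c2)
  (fun b => if b then U2 else U1) false c3 wo.
move=> /(_ _ _ _ _)/run_ext; apply.
- by move=> z; split=> [[[] h]|[h|h]]; [right|left|exists false|exists true].
- by case.
- by case.
- case=> [_|[[]]//]; left; exists false; split=> //; split=> //.
  by case.
- by left; exists true; split=> //; split=> // -[].
Qed.

Lemma run_omega (c : nat -> conf) (U : nat -> cell -> Prop) e :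
  (forall n, run (U n) (c n) (c n.+1)) ->
  (cst e : nat) = 2 -> chead e = 0 ->
  (forall z, cellv e z <-> forall n, exists m, n <= m /\ U m z) ->
  run (fun z => exists n, U n z) (c 0) e.
Proof.
move=> rs s2 h0 lim.
have wo : wellorder (fun m n : nat => is_true (m < n)).
  split; [|by move=> i j l; apply: ltn_trans|by move=> i j; lia].
  by move=> n; elim/ltn_ind: n => n IH; split.
apply: (run_sum (lt := fun m n => is_true (m < n)) (d := fun n => c n.+1)) => //.
- case=> [[]//|k _]; left; exists k; split=> //; split=> // i; lia.
- right; split; first by exists 0.
  split=> [i _|]; first by exists i.+1.
  split=> //; split=> // z; rewrite lim; split=> h n.
    by move=> _; have [m [nm Um]] := h n; exists m; split=> //; lia.
  by have [//|m [nm [_ Um]]] := h n; exists m; split=> //; lia.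
Qed.

Lemma run_start U c c' z : run U c c' -> cellv c z -> U z.
Proof. by move=> [p [_ [i0 [_ <-]] _ _ ->]] h; exists i0. Qed.

Lemma run_halts U c c' : run U c c' -> (cst c' : nat) = 1 -> halts_from P O c c'.
Proof.
move=> [[J lt f]] [/= wo [i0 [i0min fi0]] rule fin _] h1.
(* The half-open run is closed by a new last stage [None], which carries [c']. *)
pose lt' (a b : option J) : Prop := match a, b with
  | Some a, Some b => lt a b | Some _, None => True | None, _ => False end.
pose f' (a : option J) := if a is Some a then f a else c'.
have rule' b : (exists a, lt' a b) -> continues_conf lt f (fun i => lt' (Some i) b) (f' b).
  move=> [[a|] ab]; last by case: ab.
  by case: b ab => [b|] ab; [apply: rule; exists a|exact: fin].
exists (option J), lt', f'; split.
  have aS a : Acc lt' (Some a).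
    elim/(well_founded_ind (wo_wf wo)): a => a IH.
    by apply: Acc_intro => -[b|[]]; apply: IH.
  by case=> [a|]; [exact: aS|apply: Acc_intro => -[b _|[]]; exact: aS].
split; first by move=> [a|] [b|] [x|] //=; apply: (wo_trans wo).
split.
  move=> [a|] [b|] /=; [|by left|by right; right|by right; left].
  by case: (wo_total wo a b) => [h|[->|h]]; [left|right; left|right; right].
split; first by exists (Some i0); split=> // -[a|] //; apply: i0min.
split.
  case=> [i|] // j ij nb.
  case: (rule' j) => [|[m [mj [mx st]]]|[_ [nomax _]]].
  - by exists (Some i).
  - suff -> : i = m by exact: st.
    case: (wo_total wo i m) => [h|[//|h]]; first by case: (nb (Some m)).
    by case: (mx i).
  - by have [l [lj il]] := nomax _ ij; case: (nb (Some l)).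
split.
  move=> j exj dense.
  case: (rule' j exj) => [[m [mj [mx st]]]|[_ [_ [s2 [hd lim]]]]].
    have [[l|] [ml lj]] := dense (Some m) mj; last by [].
    by case: (mx l).
  split=> //; split=> //; split=> [t m|m].
    rewrite (ord1 t); apply: (iff_trans (lim (true, m))).
    split=> h i ij.
      case: i ij => [i|//] ij; have [i' [a [b e]]] := h i ij.
      by exists (Some i').
    have [[i'|] [a [b e]]] // := h (Some i) ij.
    by exists i'.
  apply: (iff_trans (lim (false, m))).
  split=> h i ij.
    case: i ij => [i|//] ij; have [i' [a [b e]]] := h i ij.
    by exists (Some i').
  have [[i'|] [a [b e]]] // := h (Some i) ij.
  by exists i'.
by exists None; split=> //; split=> // j [].
Qed.

(* [H] bounds the cells that hold 1 at some stage, and every cell of [L] does so. *)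
Definition reach (L H : cell -> Prop) (c c' : conf) :=
  (c = c' /\ forall z, ~ L z) \/
  exists U, [/\ run U c c', forall z, L z -> U z & forall z, U z -> H z].

Definition nocell : cell -> Prop := fun=> False.

Lemma reach_refl H c : reach nocell H c c.
Proof. by left; split=> // z []. Qed.

Lemma reach_run (U : cell -> Prop) c c' : run U c c' -> reach U U c c'.
Proof. by move=> r; right; exists U. Qed.

Lemma reachW L L' H H' c c' : (forall z, L' z -> L z) -> (forall z, H z -> H' z) ->
  reach L H c c' -> reach L' H' c c'.
Proof.
move=> sL sH [[-> n]|[U [r l u]]]; first by left; split=> // z /sL /n.
by right; exists U; split=> // z => [/sL/l|/u/sH].
Qed.

Lemma reach_trans L1 L2 H c1 c2 c3 : reach L1 H c1 c2 -> reach L2 H c2 c3 ->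
  reach (fun z => L1 z \/ L2 z) H c1 c3.
Proof.
move=> [[e1 n1]|[U1 [r1 l1 u1]]] [[e2 n2]|[U2 [r2 l2 u2]]].
- by subst; left; split=> // z [/n1|/n2].
- by subst; right; exists U2; split=> // z [/n1|/l2].
- by subst; right; exists U1; split=> // z; case=> [/l1|/n2].
- right; exists (fun z => U1 z \/ U2 z); split; first exact: run_trans r1 r2.
    by move=> z [/l1|/l2]; [left|right].
  by move=> z [/u1|/u2].
Qed.

Lemma reach_transl L H c1 c2 c3 : reach L H c1 c2 -> reach nocell H c2 c3 -> reach L H c1 c3.
Proof. by move=> h1 h2; apply: reachW (reach_trans h1 h2) => // z h; left. Qed.

Lemma reach_transr L L' H c1 c2 c3 : reach L' H c1 c2 -> reach L H c2 c3 -> reach L H c1 c3.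
Proof. by move=> h1 h2; apply: reachW (reach_trans h1 h2) => // z h; right. Qed.

(** A cell in [L] excludes the trivial alternative [c = c']. What remains is a nonempty run, as
    required of each piece of a concatenation. *)
Lemma reach_inv L H c c' z : reach L H c c' -> L z ->
  exists U, [/\ run U c c', forall z, L z -> U z & forall z, U z -> H z].
Proof. by move=> [[_ n]|//] /n. Qed.

Lemma orc_ans_total x : exists b, orc_ans O x b.
Proof.
case: O => [r|S] /=; first by exists false.
by case: (classic (S x)) => h; [exists true|exists false].
Qed.

End Runs.

(** * Machines operating on blocks *)

Definition write (W : real) (h : nat) (v : bool) : real :=
  fun m => if m == h then v else W m.

Lemma write_id W h : write W h (W h) = W.
Proof. by apply: functional_extensionality => m; rewrite /write; case: eqP => [->|]. Qed.

Definition owrite (O : oracle) (Q Q' : real) : real := if O is OSet _ then Q' else Q.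

Lemma owrite_id O Q : owrite O Q Q = Q.
Proof. by case: O. Qed.

Definition ones (W Q : real) : cell -> Prop := fun z => if z.1 then W z.2 else Q z.2.

Definition q_start : 'I_6 := @Ordinal 6 0 isT.
Definition q_halt : 'I_6 := @Ordinal 6 1 isT.
Definition q_limit : 'I_6 := @Ordinal 6 2 isT.
Definition q_query : 'I_6 := @Ordinal 6 3 isT.
Definition q_yes : 'I_6 := @Ordinal 6 4 isT.
Definition q_no : 'I_6 := @Ordinal 6 5 isT.

(** * Programs over an arbitrary finite type of states *)

Section FinProg.
Variables (T : finType).
Variable mu : 'I_6 + T -> bool -> bool -> ('I_6 + T) * bool * bool * bool.

Definition state_code (s : 'I_6 + T) : 'I_(#|T| + 5).+1 :=
  match s with inl i => inord i | inr t => inord (6 + enum_rank t) end.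

Definition state_decode (n : 'I_(#|T| + 5).+1) : 'I_6 + T :=
  odflt (inl q_start) [pick s | state_code s == n].

Lemma state_code_inl i : (state_code (inl i) : nat) = i.
Proof. by rewrite /= inordK //; have := ltn_ord i; lia. Qed.

Lemma state_code_inr t : (state_code (inr t) : nat) = 6 + enum_rank t.
Proof. by rewrite /= inordK // -[(_ + 5).+1]addnS [X in _ < X]addnC ltn_add2l ltn_ord. Qed.

Lemma state_code_inj : injective state_code.
Proof.
move=> s s' /(congr1 (@nat_of_ord _)).
case: s s' => [i|t] [i'|t']; rewrite ?state_code_inl ?state_code_inr.
- by move/val_inj=> ->.
- by have := ltn_ord i; lia.
- by have := ltn_ord i'; lia.
- by move/addnI/val_inj/enum_rank_inj=> ->.
Qed.

Lemma state_codeK : cancel state_code state_decode.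
Proof.
move=> s; rewrite /state_decode; case: pickP => [s' /eqP /state_code_inj //|].
by move/(_ s); rewrite eqxx.
Qed.

Definition fin_prog : prog 1 :=
  Prog (fun n r o => let: (s', w, ow, mv) := mu (state_decode n) (r ord0) o in
                     (state_code s', fun=> w, ow, mv)).

Variable O : oracle.

Definition mconf (s : 'I_6 + T) (h : nat) (W Q : real) : config 1 (nst fin_prog) :=
  Config (state_code s : 'I_(nst fin_prog + 5).+1) h (fun=> W) Q.

Lemma mconf_val s h W Q (i : 'I_6) : (cst (mconf s h W Q) : nat) = i -> s = inl i.
Proof. by rewrite -[X in _ = X]state_code_inl => /val_inj/state_code_inj. Qed.

Lemma mconf_step s h W Q s' w ow mv (H : cell -> Prop) :
  s <> inl q_halt -> s <> inl q_query -> mu s (W h) (Q h) = (s', w, ow, mv) ->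
  (forall z, ones W Q z -> H z) ->
  reach O (ones W Q) H (mconf s h W Q)
    (mconf s' (if mv then h.+1 else h.-1) (write W h w) (owrite O Q (write Q h ow))).
Proof.
move=> nh nq e sH; right; exists (ones W Q); split=> //.
have -> : ones W Q = (fun z => cellv (mconf s h W Q) z).
  by apply: functional_extensionality => -[[] m].
apply: run_step; split; first by move/(@mconf_val _ _ _ _ q_halt).
have [b ob] := orc_ans_total O Q; exists b; split=> //.
rewrite /step; case: eqP => [/(@mconf_val _ _ _ _ q_query)//|_].
by rewrite /= state_codeK e /owrite; case: (O).
Qed.

Lemma mconf_query h W Q b : orc_ans O Q b ->
  run O (ones W Q) (mconf (inl q_query) h W Q)
    (mconf (inl (if b then q_yes else q_no)) h W Q).
Proof.
move=> ob; have -> : ones W Q = (fun z => cellv (mconf (inl q_query) h W Q) z).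
  by apply: functional_extensionality => -[[] m].
apply: run_step; split; first by move/(@mconf_val _ _ _ _ q_halt).
exists b; split=> //; rewrite /step [cst _ : nat]state_code_inl /= /mconf.
by congr Config; case: (b).
Qed.

End FinProg.

(** * Blocks of seven cells *)

Definition blk := (bool * bool * bool * bool * bool * bool * bool)%type.

Definition getb (b : blk) (i : nat) : bool :=
  let: (b0, b1, b2, b3, b4, b5, b6) := b in
  match i with 0 => b0 | 1 => b1 | 2 => b2 | 3 => b3 | 4 => b4 | 5 => b5 | 6 => b6 | _ => false end.

Arguments getb !b !i.

Definition mkb (f : nat -> bool) : blk := (f 0, f 1, f 2, f 3, f 4, f 5, f 6).

Definition setb (b : blk) (i : nat) (v : bool) : blk :=
  mkb (fun j => if j == i then v else getb b j).

Definition blk0 : blk := mkb (fun=> false).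

Lemma getb_mkb f i : i < 7 -> getb (mkb f) i = f i.
Proof. by do 7 (case: i => [//|i]). Qed.

Lemma eq_blk b b' : (forall i, i < 7 -> getb b i = getb b' i) -> b = b'.
Proof.
case: b => [[[[[[b0 b1] b2] b3] b4] b5] b6]; case: b' => [[[[[[a0 a1] a2] a3] a4] a5] a6] h.
by move: (h 0 isT) (h 1 isT) (h 2 isT) (h 3 isT) (h 4 isT) (h 5 isT) (h 6 isT)
  => /= -> -> -> -> -> -> ->.
Qed.

Definition getblk (W : real) (q : nat) : blk := mkb (fun i => W (7 * q + i)).

Lemma getb_getblk W q i : i < 7 -> getb (getblk W q) i = W (7 * q + i).
Proof. exact: getb_mkb. Qed.

(** A macro step rewrites a block from its last cell downwards; this is the tape when the cells at
    offset [i] and above are done. *)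
Definition upd_from (W : real) (q : nat) (n : blk) (i : nat) : real :=
  fun m => if (m %/ 7 == q) && (i <= m %% 7) then getb n (m %% 7) else W m.

Notation upd W q n := (upd_from W q n 0).

Lemma upd_from7 W q n : upd_from W q n 7 = W.
Proof.
apply: functional_extensionality => m; rewrite /upd_from.
by rewrite [7 <= _]leqNgt ltn_pmod // andbF.
Qed.

Lemma write_upd W q n i : i < 7 ->
  write (upd_from W q n i.+1) (7 * q + i) (getb n i) = upd_from W q n i.
Proof.
move=> i7; apply: functional_extensionality => m; rewrite /write /upd_from.
case: eqP => [->|ne].
  have -> : (7 * q + i) %/ 7 = q by lia.
  have -> : (7 * q + i) %% 7 = i by lia.
  by rewrite eqxx leqnn.
case: eqP => //= mq; have -> // : (i < m %% 7) = (i <= m %% 7).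
by apply/idP/idP; lia.
Qed.

Lemma upd_id W q : upd W q (getblk W q) = W.
Proof.
apply: functional_extensionality => m; rewrite /upd_from leq0n andbT.
case: eqP => // mq; rewrite getb_getblk ?ltn_pmod //; congr (W _); lia.
Qed.

(** The inner states of a macro step: [Rd] carries the bits collected so far, [Wr] the target state
    and the blocks still to be written, and [Mv] the number of moves left. *)
Inductive micro (M : Type) :=
  | Rd of M & 'I_7 & blk & blk
  | Wr of M & option bool & blk & blk & 'I_7
  | Mv of M & option bool & 'I_7.

Section MicroFin.
Variable M : finType.

Definition micro_code (m : micro M) :
    M * 'I_7 * blk * blk + M * option bool * blk * blk * 'I_7 + M * option bool * 'I_7 :=
  match m with
  | Rd s i a b => inl (inl (s, i, a, b))
  | Wr s d a b i => inl (inr (s, d, a, b, i))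
  | Mv s d i => inr (s, d, i)
  end.

Definition micro_decode
    (x : M * 'I_7 * blk * blk + M * option bool * blk * blk * 'I_7 + M * option bool * 'I_7) :=
  match x with
  | inl (inl (s, i, a, b)) => Rd s i a b
  | inl (inr (s, d, a, b, i)) => Wr s d a b i
  | inr (s, d, i) => Mv s d i
  end.

Lemma micro_codeK : cancel micro_code micro_decode.
Proof. by case. Qed.

HB.instance Definition _ := Finite.copy (micro M) (can_type micro_codeK).
End MicroFin.

(** * Macro steps: reading, rewriting and leaving a block *)

Section MacroProg.
Variable N : finType.
Notation mstate := ('I_6 + N)%type.
Variable mdelta : mstate -> blk -> blk -> mstate * blk * blk * option bool.

Definition tstate : finType := (N + micro mstate)%type.

Definition mac (s : mstate) : 'I_6 + tstate :=
  match s with inl i => inl i | inr n => inr (inl n) end.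

Definition mic (m : micro mstate) : 'I_6 + tstate := inr (inr m).

Definition read_step (s : mstate) (i : nat) (aw aq : blk) (w o : bool) :
    ('I_6 + tstate) * bool * bool * bool :=
  let aw' := setb aw i w in let aq' := setb aq i o in
  if i < 6 then (mic (Rd s (inord i.+1) aw' aq'), w, o, true)
  else let: (s', nw, nq, d) := mdelta s aw' aq' in
       (mic (Wr s' d nw nq (inord 5)), getb nw 6, getb nq 6, false).

(* One macro step: a sweep to the right collects the seven bits of the block on
   both tapes, a sweep back to the left rewrites them, and the head then moves
   to the neighbouring block. *)
Definition micro_delta (s : 'I_6 + tstate) (w o : bool) : ('I_6 + tstate) * bool * bool * bool :=
  match s with
  | inl i => read_step (inl i) 0 blk0 blk0 w o
  | inr (inl n) => read_step (inr n) 0 blk0 blk0 w o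
  | inr (inr (Rd s i aw aq)) => read_step s i aw aq w o
  | inr (inr (Wr s d nw nq i)) =>
      if 0 < i then (mic (Wr s d nw nq (inord i.-1)), getb nw i, getb nq i, false)
      else (mic (Mv s d (inord (if d is None then 1 else 6))), getb nw 0, getb nq 0,
            if d is Some false then false else true)
  | inr (inr (Mv s d i)) =>
      (if 1 < i then mic (Mv s d (inord i.-1)) else mac s, w, o,
       if d is Some true then true else false)
  end.

Definition macro_prog : prog 1 := fin_prog micro_delta.

Variable O : oracle.

Notation tconf := (mconf micro_delta).
Notation treach := (@reach macro_prog O).

Definition moveq (d : option bool) (q : nat) : nat :=
  match d with Some true => q.+1 | Some false => q.-1 | None => q end.

Section OneStep.
Variables (s s' : mstate) (q : nat) (W Q : real) (nw nq : blk) (d : option bool).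
Variable H : cell -> Prop.
Hypotheses (nh : s <> inl q_halt) (nqu : s <> inl q_query).
Hypothesis ds : mdelta s (getblk W q) (getblk Q q) = (s', nw, nq, d).
Hypothesis HW : forall z, ones W Q z -> H z.
Let W' := upd W q nw.
Let Q' := owrite O Q (upd Q q nq).
Hypothesis HW' : forall z, ones W' Q' z -> H z.

Let acc (V : real) (i : nat) : blk := mkb (fun j => (j < i) && V (7 * q + j)).

Let set_acc V i : setb (acc V i) i (V (7 * q + i)) = acc V i.+1.
Proof.
apply: eq_blk => j j7; rewrite /setb /acc !getb_mkb //.
case: eqP => [->|ne]; first by rewrite ltnSn.
by have -> : (j < i) = (j < i.+1) by lia.
Qed.

Let acc0 V : acc V 0 = blk0.
Proof. by []. Qed.

Let acc7 V : acc V 7 = getblk V q.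
Proof. by apply: eq_blk => j j7; rewrite !getb_mkb // j7. Qed.

Let rd i : 'I_6 + tstate := if i == 0 then mac s else mic (Rd s (inord i) (acc W i) (acc Q i)).

Let rd_delta i : i < 7 -> micro_delta (rd i) (W (7 * q + i)) (Q (7 * q + i)) =
  read_step s i (acc W i) (acc Q i) (W (7 * q + i)) (Q (7 * q + i)).
Proof.
rewrite /rd; case: eqP => [-> _|_ i7]; first by rewrite !acc0; case: (s).
by rewrite /= inordK.
Qed.

Let rd_nspec i : rd i <> inl q_halt /\ rd i <> inl q_query.
Proof.
rewrite /rd; case: eqP => _; last by [].
by case: (s) nh nqu => //= i' h h'; split=> -[e]; [apply: h|apply: h']; rewrite e.
Qed.

Let micro_step st h V R st' h' V' R' w ow mv :
  st <> inl q_halt -> st <> inl q_query -> (forall z, ones V R z -> H z) ->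
  micro_delta st (V h) (R h) = (st', w, ow, mv) -> h' = (if mv then h.+1 else h.-1) ->
  V' = write V h w -> R' = owrite O R (write R h ow) ->
  treach (ones V R) H (tconf st h V R) (tconf st' h' V' R').
Proof. by move=> a b e g -> -> ->; apply: mconf_step. Qed.

Let rd_step i : i < 6 ->
  treach (ones W Q) H (tconf (rd i) (7 * q + i) W Q) (tconf (rd i.+1) (7 * q + i.+1) W Q).
Proof.
move=> i6; have [nh' nq'] := rd_nspec i.
apply: micro_step => //.
- by rewrite rd_delta ?(ltn_trans i6) // /read_step i6 !set_acc.
- by rewrite addnS.
- by rewrite write_id.
- by rewrite write_id owrite_id.
Qed.

Let rd_run :
  treach (ones W Q) H (tconf (mac s) (7 * q) W Q) (tconf (rd 6) (7 * q + 6) W Q).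
Proof.
rewrite -[7 * q in X in reach _ _ _ X]addn0.
apply: reach_transl (rd_step (i := 0) isT) _.
have w i : i < 6 -> treach nocell H (tconf (rd i) (7 * q + i) W Q) (tconf (rd i.+1) (7 * q + i.+1) W Q).
  by move=> i6; apply: reachW (rd_step i6).
do 4 (apply: reach_transl; first exact: w).
exact: w.
Qed.

Let Wi i := upd_from W q nw i.
Let Qi i := owrite O Q (upd_from Q q nq i).

(** Midway through the rewriting each cell has its old or its new value, so the bounds at the two
    ends suffice. *)
Let HWi i z : ones (Wi i) (Qi i) z -> H z.
Proof.
case: z => [[] m]; rewrite /ones /=.
  move=> h; have [e|e] : Wi i m = W m \/ Wi i m = W' m.
  - by rewrite /Wi /W' /upd_from /=; case: (m %/ 7 == q) => /=; [case: (i <= _)|left]; auto.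
  - by apply: HW; rewrite /ones /= -e.
  - by apply: HW'; rewrite /ones /= -e.
move=> h; have [e|e] : Qi i m = Q m \/ Qi i m = Q' m.
- rewrite /Qi /Q' /upd_from /owrite; case: (O) => [_|_]; first by left.
  by case: (m %/ 7 == q) => /=; [case: (i <= _)|left]; auto.
- by apply: HW; rewrite /ones /= -e.
- by apply: HW'; rewrite /ones /= -e.
Qed.

Let write_Q i : i < 7 -> Qi i = owrite O (Qi i.+1) (write (Qi i.+1) (7 * q + i) (getb nq i)).
Proof. by move=> i7; rewrite /Qi /owrite; case: (O) => // _; rewrite write_upd. Qed.

Let wr i := mic (Wr s' d nw nq (inord i)).

Let turn : treach nocell H (tconf (rd 6) (7 * q + 6) W Q) (tconf (wr 5) (7 * q + 5) (Wi 6) (Qi 6)).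
Proof.
have [nh' nq'] := rd_nspec 6.
apply: reachW (micro_step (w := getb nw 6) (ow := getb nq 6) (mv := false) nh' nq' HW _ _ _ _) => //.
- by rewrite rd_delta // /read_step /= !set_acc !acc7 ds.
- by lia.
- by rewrite /Wi -(write_upd _ _ _ (i := 6)) // upd_from7.
- by rewrite write_Q // /Qi upd_from7 owrite_id.
Qed.

Let wr_step i : i.+1 < 6 -> treach nocell H
  (tconf (wr i.+1) (7 * q + i.+1) (Wi i.+2) (Qi i.+2)) (tconf (wr i) (7 * q + i) (Wi i.+1) (Qi i.+1)).
Proof.
move=> i6; have i7 : i.+1 < 7 by lia.
apply: reachW (micro_step (st := wr i.+1) (w := getb nw i.+1) (ow := getb nq i.+1)
  (mv := false) _ _ (HWi (i := i.+2)) _ _ _ _) => //.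
- by rewrite /= inordK.
- by lia.
- by rewrite /Wi write_upd.
- by rewrite -write_Q.
Qed.

Let mvs j := mic (Mv s' d (inord j)).
(** Writing cell 0 of the block already makes the first of the seven moves to a neighbour; a head
    that stays in its block steps right and comes back, since every step moves. In [dpos] the
    truncated subtraction accounts for a head resting at cell 0 of the tape. *)
Let dn : nat := if d is None then 1 else 6.
Let dpos j := match d with
  Some true => 7 * q + (7 - j) | Some false => 7 * q - (7 - j) | None => 7 * q + j end.

Let wr0 : treach nocell H (tconf (wr 0) (7 * q + 0) (Wi 1) (Qi 1)) (tconf (mvs dn) (dpos dn) W' Q').
Proof.
apply: reachW (micro_step (st := wr 0) (w := getb nw 0) (ow := getb nq 0)
  (mv := if d is Some false then false else true) _ _ (HWi (i := 1)) _ _ _ _) => //.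
- by rewrite /= inordK.
- by rewrite /dpos /dn; case: (d) => [[]|]; lia.
- by rewrite /W' write_upd.
- by rewrite /Q' -[owrite O Q _]/(Qi 0) write_Q.
Qed.

Let mv_step j : j < 6 -> treach nocell H (tconf (mvs j.+1) (dpos j.+1) W' Q')
   (tconf (if j == 0 then mac s' else mvs j) (dpos j) W' Q').
Proof.
move=> j6.
apply: reachW (micro_step (st := mvs j.+1) (w := W' (dpos j.+1)) (ow := Q' (dpos j.+1))
  (mv := if d is Some true then true else false) _ _ HW' _ _ _ _) => //.
- by rewrite /= inordK //; case: (j).
- by rewrite /dpos; case: (d) => [[]|]; lia.
- by rewrite write_id.
- by rewrite write_id owrite_id.
Qed.

Lemma macro_step_ones :
  treach (ones W Q) H (tconf (mac s) (7 * q) W Q) (tconf (mac s') (7 * moveq d q) W' Q').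
Proof.
apply: reach_transl rd_run _.
apply: reach_transl turn _.
do 5 (apply: reach_transl; first exact: wr_step).
apply: reach_transl wr0 _.
have -> : 7 * moveq d q = dpos 0 by rewrite /dpos /moveq; case: (d) => [[]|]; lia.
have -> : mac s' = if 0 == 0 then mac s' else mvs 0 by [].
have [->|->] : dn = 6 \/ dn = 1 by rewrite /dn; case: (d); auto.
  do 5 (apply: reach_transl; first exact: mv_step).
  exact: mv_step.
exact: mv_step.
Qed.

End OneStep.
End MacroProg.

Definition btape (F : nat -> blk) : real := fun m => getb (F (m %/ 7)) (m %% 7).

Lemma btapeE F q i : i < 7 -> btape F (7 * q + i) = getb (F q) i.
Proof.
move=> i7; rewrite /btape.
have -> : (7 * q + i) %/ 7 = q by lia.
by have -> : (7 * q + i) %% 7 = i by lia.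
Qed.

Lemma getblk_btape F q : getblk (btape F) q = F q.
Proof. by apply: eq_blk => i i7; rewrite getb_getblk // btapeE. Qed.

Lemma btape_getblk W : btape (getblk W) = W.
Proof.
apply: functional_extensionality => m.
by rewrite /btape getb_getblk ?ltn_pmod //; congr (W _); lia.
Qed.

Lemma upd_btape F q n : upd (btape F) q n = btape (fun r => if r == q then n else F r).
Proof.
apply: functional_extensionality => m; rewrite /upd_from leq0n andbT /btape.
by case: eqP.
Qed.

(** * Finite walks and infinite sweeps over blocks *)

Section MacroRuns.
Variable N : finType.
Notation mstate := ('I_6 + N)%type.
Variable mdelta : mstate -> blk -> blk -> mstate * blk * blk * option bool.
Variable O : oracle.
Notation treach := (@reach (macro_prog mdelta) O).

Definition bconf (s : mstate) (q : nat) (F : nat -> blk) (Q : real) :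
    config 1 (nst (macro_prog mdelta)) :=
  mconf (micro_delta mdelta) (mac s) (7 * q) (btape F) Q.

Definition active (s : mstate) := s <> inl q_halt /\ s <> inl q_query.

Lemma macro_step s q F Q s' q' F' Q' n nq d (H : cell -> Prop) : active s ->
  mdelta s (F q) (getblk Q q) = (s', n, nq, d) ->
  F' = (fun r => if r == q then n else F r) -> Q' = owrite O Q (upd Q q nq) ->
  q' = moveq d q ->
  (forall z, ones (btape F) Q z -> H z) -> (forall z, ones (btape F') Q' z -> H z) ->
  treach (ones (btape F) Q) H (bconf s q F Q) (bconf s' q' F' Q').
Proof.
move=> [nh nqu] e -> -> -> h h'.
rewrite /bconf -upd_btape; apply: macro_step_ones nh nqu _ h _.
  by rewrite getblk_btape; exact: e.
by rewrite upd_btape.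
Qed.

Lemma macro_move s q F Q s' q' d (H : cell -> Prop) : active s ->
  mdelta s (F q) (getblk Q q) = (s', F q, getblk Q q, d) -> q' = moveq d q ->
  (forall z, ones (btape F) Q z -> H z) ->
  treach nocell H (bconf s q F Q) (bconf s' q' F Q).
Proof.
move=> a e eq' h; apply: reachW (macro_step a e _ _ eq' h h) => //.
  by apply: functional_extensionality => r; case: eqP => [->|].
by rewrite upd_id owrite_id.
Qed.

Lemma walk_right s F Q q n (H : cell -> Prop) : active s ->
  (forall i, q <= i < q + n ->
     mdelta s (F i) (getblk Q i) = (s, F i, getblk Q i, Some true)) ->
  (forall z, ones (btape F) Q z -> H z) ->
  treach nocell H (bconf s q F Q) (bconf s (q + n) F Q).
Proof.
move=> a e h; elim: n e => [|n IH] e; first by rewrite addn0; apply: reach_refl.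
apply: reach_transl (IH _) _; first by move=> i ?; apply: e; lia.
by apply: macro_move a (e _ _) _ h; [lia|rewrite addnS].
Qed.

Lemma walk_left (s : nat -> mstate) F Q q n (H : cell -> Prop) :
  (forall i, active (s i)) -> n <= q ->
  (forall i, i < n ->
     mdelta (s i) (F (q - i)) (getblk Q (q - i)) =
       (s i.+1, F (q - i), getblk Q (q - i), Some false)) ->
  (forall z, ones (btape F) Q z -> H z) ->
  treach nocell H (bconf (s 0) q F Q) (bconf (s n) (q - n) F Q).
Proof.
move=> a nq e h; elim: n nq e => [|n IH] nq e; first by rewrite subn0; apply: reach_refl.
apply: reach_transl (IH _ _) _; [by lia|by move=> i ?; apply: e; lia|].
by apply: macro_move (a n) (e _ _) _ h; [lia|rewrite /=; lia].
Qed.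

(** In a rightward pass of [omega] macro steps each cell has its final value once the head has left
    its block, so the limsup is the tape [F']. *)
Lemma sweep (s : nat -> mstate) F F' Q q (H : cell -> Prop) :
  (forall r, q <= r -> active (s r)) ->
  (forall r, r < q -> F r = F' r) ->
  (forall r, q <= r ->
     mdelta (s r) (F r) (getblk Q r) = (s r.+1, F' r, getblk Q r, Some true)) ->
  (forall z, ones (btape F) Q z -> H z) -> (forall z, ones (btape F') Q z -> H z) ->
  treach nocell H (bconf (s q) q F Q) (bconf (inl q_limit) 0 F' Q).
Proof.
move=> a low e hF hF'.
(* The tape at the moment when the blocks below [r] have been treated. *)
pose mix r := fun i => if i < r then F' i else F i.
have hmix r z : ones (btape (mix r)) Q z -> H z.
  case: z => [[] m] /=; rewrite /ones /btape /mix /=; last by move=> h; apply: hF.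
  by case: ifP => _ h; [apply: (hF' (true, m))|apply: (hF (true, m))].
pose c n := bconf (s (q + n)) (q + n) (mix (q + n)) Q.
have st n : exists U, [/\ run O U (c n) (c n.+1),
    forall z, ones (btape (mix (q + n))) Q z -> U z &
    forall z, U z -> ones (btape (mix (q + n))) Q z \/ ones (btape (mix (q + n.+1))) Q z].
  have := @macro_step (s (q + n)) (q + n) (mix (q + n)) Q (s (q + n.+1)) (q + n.+1)
    (mix (q + n.+1)) Q (F' (q + n)) (getblk Q (q + n)) (Some true)
    (fun z => ones (btape (mix (q + n))) Q z \/ ones (btape (mix (q + n.+1))) Q z).
  case.
  - by apply: a; lia.
  - by rewrite {1}/mix ltnn addnS; apply: e; lia.
  - apply: functional_extensionality => r; rewrite /mix addnS ltnS leq_eqVlt.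
    by case: eqP => [->|].
  - by rewrite upd_id owrite_id.
  - by rewrite addnS.
  - by left.
  - by right.
  (* The two heads are in different blocks, so the macro step is not trivial. *)
  - by move=> [/(congr1 (@chead _ _)) /=]; lia.
  - by move=> [U [r l u]]; exists U.
have [U UP] := fun_choice st.
have r0 : run O (fun z => exists n, U n z) (c 0) (bconf (inl q_limit) 0 F' Q).
  apply: run_omega.
  - by move=> n; case: (UP n).
  - exact: state_code_inl.
  - by rewrite /= muln0.
  - move=> z.
    have ev n : z.2 %/ 7 < q + n -> ones (btape (mix (q + n))) Q z <-> ones (btape F') Q z.
      by rewrite /ones; case: z => -[] m //= h; rewrite /btape /mix h.
    have -> : (cellv (bconf (inl q_limit) 0 F' Q) z : Prop) = ones (btape F') Q z.
      by rewrite /ones /cellv; case: (z.1).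
    split=> [h n|/(_ (z.2 %/ 7).+1) [m [lm Um]]].
      exists (maxn n (z.2 %/ 7).+1); split; first by lia.
      by case: (UP (maxn n (z.2 %/ 7).+1)) => _ l _; apply: l; apply/ev => //; lia.
    by case: (UP m) => _ _ /(_ z Um) [] /ev; apply; lia.
have <- : c 0 = bconf (s q) q F Q.
  rewrite /c addn0 /bconf; congr mconf; congr btape.
  by apply: functional_extensionality => r; rewrite /mix; case: ltnP => // /low.
apply: reachW (reach_run r0) => // z [n Un].
by case: (UP n) => _ _ /(_ z Un) [] /hmix.
Qed.

End MacroRuns.

(** * The simulating machine *)

(** The first stretching round inserts seven cells: six that complete the block of the first input
    bit, and a frontier mark. Each later round turns the old mark into the [g] cell of a block and
    inserts only six, so six displaced bits are carried along. *)
Definition blk6 := (bool * bool * bool * bool * bool * bool)%type.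

(* [CountLeft] to [PutA] perform a simulated step: find [p mod 7], find the mark [b]
   and read the oracle cell, find the mark [a], read and rewrite the simulated
   cells, go back to rewrite the oracle cell, and move the marks [b] and then [a].
   [Flash] to [Shift6] stretch the input; the argument of a shift state is the
   content displaced from the blocks on the left. *)
Inductive sim (S : Type) :=
  | CountLeft of S & 'I_7
  | FindB of S & 'I_7
  | ReadA of S & 'I_7 & bool
  | WriteB of S & 'I_7 & bool & bool
  | PutB of S & bool
  | LiftA of S & bool
  | PutA of S
  | Flash
  | Frontier
  | Shift7 of blk
  | Shift6 of blk6
  | Erase.

Arguments Flash {S}.
Arguments Frontier {S}.
Arguments Shift7 {S}.
Arguments Shift6 {S}.
Arguments Erase {S}.

Section SimFin.
Variable S : finType.

Definition sim_sum : finType :=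
  (S * 'I_7 + S * 'I_7 + S * 'I_7 * bool + S * 'I_7 * bool * bool + S * bool + S * bool + S
   + unit + unit + blk + blk6 + unit)%type.

Definition sim_code (s : sim S) : sim_sum :=
  match s with
  | CountLeft s j => inl (inl (inl (inl (inl (inl (inl (inl (inl (inl (inl (s, j)))))))))))
  | FindB s j => inl (inl (inl (inl (inl (inl (inl (inl (inl (inl (inr (s, j)))))))))))
  | ReadA s j o => inl (inl (inl (inl (inl (inl (inl (inl (inl (inr (s, j, o))))))))))
  | WriteB s j o m => inl (inl (inl (inl (inl (inl (inl (inl (inr (s, j, o, m)))))))))
  | PutB s m => inl (inl (inl (inl (inl (inl (inl (inr (s, m))))))))
  | LiftA s m => inl (inl (inl (inl (inl (inl (inr (s, m)))))))
  | PutA s => inl (inl (inl (inl (inl (inr s)))))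
  | Flash => inl (inl (inl (inl (inr tt))))
  | Frontier => inl (inl (inl (inr tt)))
  | Shift7 q => inl (inl (inr q))
  | Shift6 q => inl (inr q)
  | Erase => inr tt
  end.

Definition sim_decode (x : sim_sum) : sim S :=
  match x with
  | inl (inl (inl (inl (inl (inl (inl (inl (inl (inl (inl (s, j))))))))))) => CountLeft s j
  | inl (inl (inl (inl (inl (inl (inl (inl (inl (inl (inr (s, j))))))))))) => FindB s j
  | inl (inl (inl (inl (inl (inl (inl (inl (inl (inr (s, j, o)))))))))) => ReadA s j o
  | inl (inl (inl (inl (inl (inl (inl (inl (inr (s, j, o, m))))))))) => WriteB s j o m
  | inl (inl (inl (inl (inl (inl (inl (inr (s, m)))))))) => PutB s m
  | inl (inl (inl (inl (inl (inl (inr (s, m))))))) => LiftA s m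
  | inl (inl (inl (inl (inl (inr s))))) => PutA s
  | inl (inl (inl (inl (inr _)))) => Flash
  | inl (inl (inl (inr _))) => Frontier
  | inl (inl (inr q)) => Shift7 q
  | inl (inr q) => Shift6 q
  | inr _ => Erase
  end.

Lemma sim_codeK : cancel sim_code sim_decode.
Proof. by case. Qed.

HB.instance Definition _ := Finite.copy (sim S) (can_type sim_codeK).
End SimFin.

Lemma upd_setb Q b j v : j < 7 -> upd Q b (setb (getblk Q b) j v) = write Q (7 * b + j) v.
Proof.
move=> j7; apply: functional_extensionality => m; rewrite /upd_from leq0n andbT /write.
case: (eqVneq (m %/ 7) b) => mb.
  rewrite getb_mkb ?ltn_pmod // getb_getblk ?ltn_pmod //.
  have -> : (m %% 7 == j) = (m == 7 * b + j) by lia.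
  by case: eqP => // _; congr (Q _); lia.
by have -> : (m == 7 * b + j) = false by lia.
Qed.

Definition i30 : 'I_3 := @Ordinal 3 0 isT.
Definition i31 : 'I_3 := @Ordinal 3 1 isT.
Definition i32 : 'I_3 := @Ordinal 3 2 isT.

Section Simulation.
Variable P : prog 3.
Notation S := ('I_(nst P + 5).+1).
Notation mstate := ('I_6 + sim S)%type.

(* The queries and their answers must use the actual query and answer states; the
   start, halt and limit states of the simulated machine are ordinary states. *)
Definition sim_state (s : S) : mstate :=
  match (s : nat) with
  | 3 => inl q_query | 4 => inl q_yes | 5 => inl q_no | _ => inr (CountLeft s ord0)
  end.

(** In the limit state block 0 decides: [h = 0] means that the output is ready, [b = 1] a simulated
    limit, [a = 1] with [b = 0] that the whole input is stretched; otherwise another round starts.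
    When a simulated halt state arrives at block 0, the output bit [d2] is put into cell 0 and
    [Erase] starts. *)
Definition sim_delta (st : mstate) (r rq : blk) : mstate * blk * blk * option bool :=
  let: (g, x, h, d1, d2, a, b) := r in
  match st with
  | inl i =>
      match (i : nat) with
      | 0 => (inr (Shift7 (false, x, h, d1, d2, a, b)),
              (false, g, true, false, false, false, false), rq, Some true)
      | 2 => if ~~ h then (inl q_halt, r, rq, None)
             else if b then
               (inr (CountLeft (inord 2) ord0), (g, x, h, d1, d2, false, false), rq, None)
             else if a then
               (inr (CountLeft (inord 0) ord0), (g, x, h, d1, d2, false, b), rq, None)
             else (inr Flash, (g, x, h, d1, d2, true, b), rq, None)
      | 4 => (inr (CountLeft (inord 4) ord0), r, rq, None)
      | 5 => (inr (CountLeft (inord 5) ord0), r, rq, None)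
      | _ => (inl q_halt, r, rq, None)
      end
  | inr (CountLeft s j) =>
      if g then (inr (CountLeft s (inord (j.+1 %% 7))), r, rq, Some false)
      else if (s : nat) == 1 then
        (inr Erase, (d2, false, false, false, false, false, false), rq, Some true)
      else (inr (FindB s j), r, rq, None)
  | inr (FindB s j) =>
      if b then (st, r, rq, Some true) else (inr (ReadA s j (getb rq j)), r, rq, None)
  | inr (ReadA s j o) =>
      if a then (st, r, rq, Some true)
      else let: (s', w, ow, mv) := delta P s (fun i => nth false [:: x; d1; d2] i) o in
           (inr (WriteB s' j ow mv), (g, w i30, h, w i31, w i32, a, b), rq, None)
  | inr (WriteB s j ow mv) =>
      if b then (st, r, rq, Some false)
      else (inr (PutB s mv), (g, x, h, d1, d2, a, true), setb rq j ow,
            if mv then (if j == 6 :> nat then Some true else None)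
            else (if j == 0 :> nat then Some false else None))
  | inr (PutB s mv) => (inr (LiftA s mv), (g, x, h, d1, d2, a, false), rq, None)
  | inr (LiftA s mv) =>
      if a then (st, r, rq, Some true)
      else (inr (PutA s), (g, x, h, d1, d2, true, b), rq, Some mv)
  | inr (PutA s) => (sim_state s, (g, x, h, d1, d2, false, b), rq, None)
  | inr Flash => (inr Frontier, (g, x, h, d1, d2, false, b), rq, Some true)
  | inr Frontier =>
      if g then (st, r, rq, Some true)
      else (inr (Shift6 (false, h, d1, d2, a, b)),
            (true, x, true, false, false, true, true), rq, Some true)
  | inr (Shift7 q) => (inr (Shift7 r), q, rq, Some true)
  | inr (Shift6 (q0, q1, q2, q3, q4, q5)) =>
      (inr (Shift6 (x, h, d1, d2, a, b)), (q0, q1, q2, q3, q4, q5, g), rq, Some true)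
  | inr Erase => (inr Erase, blk0, rq, Some true)
  end.

Notation sim_prog := (macro_prog sim_delta).

Variable O : oracle.
Notation sreach := (@reach sim_prog O).
Notation sconf := (bconf sim_delta).

Definition simF (t : 'I_3 -> real) (a b : nat -> bool) (r : nat) : blk :=
  (r != 0, t i30 r, true, t i31 r, t i32 r, a r, b r).

Definition allT : nat -> bool := fun=> true.

(* The cells that hold 1 when the marks are lifted. *)
Definition full (g : config 3 (nst P)) : cell -> Prop :=
  ones (btape (simF (ctapes g) allT allT)) (cotape g).

(** The form in which a simulated limit first appears: the limsup has filled both mark tracks with
    1. *)
Definition lconf (g : config 3 (nst P)) : config 1 (nst sim_prog) :=
  sconf (inl q_limit) 0 (simF (ctapes g) allT allT) (cotape g).

Definition simconf (g : config 3 (nst P)) : config 1 (nst sim_prog) :=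
  sconf (sim_state (cst g)) (chead g)
    (simF (ctapes g) (fun r => r != chead g) (fun r => r != chead g %/ 7)) (cotape g).

Lemma getb_simF_full t a b r i : getb (simF t a b r) i -> getb (simF t allT allT r) i.
Proof. by do 7 (case: i => [//|i]). Qed.

Lemma btape_simF_full t a b m : btape (simF t a b) m -> btape (simF t allT allT) m.
Proof. exact: getb_simF_full. Qed.

(** Only the answer states 4 and 5 need a macro step to begin the walk; the other states are encoded
    as [CountLeft] states. *)
Lemma sim_state_start (s : S) (H : cell -> Prop) q F Q :
  (s : nat) <> 3 -> (forall z, ones (btape F) Q z -> H z) ->
  sreach nocell H (sconf (sim_state s) q F Q) (sconf (inr (CountLeft s ord0)) q F Q).
Proof.
move=> n3 h; rewrite /sim_state.
have st (i : 'I_6) : (i : nat) = s -> 4 <= s < 6 ->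
    sreach nocell H (sconf (inl i) q F Q) (sconf (inr (CountLeft s ord0)) q F Q).
  move=> ei s46.
  refine (macro_move (H := H) (d := None) _ _ _ _ h) => //.
    by split=> -[e]; move: ei s46; rewrite e /= => <-.
  have -> : s = inord i by apply: val_inj; rewrite /= inordK ei.
  case: (F q) => [[[[[[? ?] ?] ?] ?] ?] ?].
  by case: i ei => -[|[|[|[|[|[|m]]]]]] //= _ e; move: s46; rewrite -e.
case es: (s : nat) => [|[|[|[|[|[|m]]]]]]; try exact: reach_refl.
- by case: n3.
- by apply: st; rewrite es.
- by apply: st; rewrite es.
Qed.

(** * Simulation of one ordinary step *)

Section Step.
Variables (g : config 3 (nst P)) (b : bool).
Hypotheses (n1 : (cst g : nat) <> 1) (n3 : (cst g : nat) <> 3).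
Let g' := step P O b g.
Let s := cst g.
Let p := chead g.
Let t := ctapes g.
Let Q := cotape g.
Let H z := full g z \/ full g' z.
Let j : 'I_7 := inord (p %% 7).
Let bp := p %/ 7.

Variables (s' : S) (w : 'I_3 -> bool) (ow mv : bool).
Hypothesis dE : delta P s (fun i => t i p) (Q p) = (s', w, ow, mv).
Let p' := if mv then p.+1 else p.-1.
Let t' : 'I_3 -> real := fun i m => if m == p then w i else t i m.
Let Q' := owrite O Q (write Q p ow).

Let g'E : g' = Config s' p' t' Q'.
Proof.
rewrite /g' /step; case: eqP => // _.
by move: dE; rewrite /s /t /p /Q => ->; rewrite /Q' /owrite; case: (O).
Qed.

(** Each intermediate tape combines old or new contents with some marks, and [full] has 1 on both
    mark tracks. *)
Let hH tt QQ a1 b1 : tt = t \/ tt = t' -> QQ = Q \/ QQ = Q' ->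
  forall z, ones (btape (simF tt a1 b1)) QQ z -> H z.
Proof.
move=> ht hQ [[] m]; rewrite /H /full /ones g'E /=.
  by move=> /btape_simF_full; case: ht => ->; [left|right].
by case: hQ => ->; [left|right].
Qed.

Lemma sim_step_aux : sreach (full g) H (simconf g) (simconf g').
Proof.
have j7 : (j : nat) = p %% 7 by rewrite /j inordK ?ltn_pmod.
have pE : p = 7 * bp + j by rewrite j7 /bp; lia.
pose A := fun r : nat => r != p.
pose B := fun r : nat => r != bp.
have h1 a1 b1 : forall z, ones (btape (simF t a1 b1)) Q z -> H z by apply: hH; left.
have h2 a1 b1 : forall z, ones (btape (simF t' a1 b1)) Q z -> H z by apply: hH; [right|left].
have h3 a1 b1 : forall z, ones (btape (simF t' a1 b1)) Q' z -> H z by apply: hH; right.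
have c01 : sreach nocell H (simconf g) (sconf (inr (CountLeft s ord0)) p (simF t A B) Q).
  by apply: sim_state_start => //; apply: h1.
have c12 : sreach nocell H (sconf (inr (CountLeft s ord0)) p (simF t A B) Q)
    (sconf (inr (CountLeft s j)) 0 (simF t A B) Q).
  have := @walk_left _ sim_delta O (fun i => inr (CountLeft s (inord (i %% 7)))) (simF t A B) Q p p H.
  rewrite subnn (_ : inord (0 %% 7) = ord0); last by apply: val_inj; rewrite /= inordK.
  apply=> // [i ip|]; last exact: h1.
  rewrite /= subn_eq0 leqNgt ip /= inordK ?ltn_pmod //.
  by have -> : (i %% 7).+1 %% 7 = i.+1 %% 7 by lia.
have c23 : sreach (ones (btape (simF t A B)) Q) H (sconf (inr (CountLeft s j)) 0 (simF t A B) Q)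
    (sconf (inr (FindB s j)) 0 (simF t A B) Q).
  refine (macro_step (H := H) (d := None) _ _ _ _ _ (h1 _ _) (h1 _ _)) => //.
  - by rewrite /=; case: eqP.
  - by apply: functional_extensionality => r; case: (r =P 0) => [->|_].
  - by rewrite upd_id owrite_id.
have c34 : sreach nocell H (sconf (inr (FindB s j)) 0 (simF t A B) Q)
    (sconf (inr (FindB s j)) bp (simF t A B) Q).
  have := @walk_right _ sim_delta O (inr (FindB s j)) (simF t A B) Q 0 bp H.
  rewrite add0n; apply=> // [i ib|]; last exact: h1.
  rewrite /= {1}/B.
  by have -> : i != bp by lia.
have c45 : sreach nocell H (sconf (inr (FindB s j)) bp (simF t A B) Q)
    (sconf (inr (ReadA s j (Q p))) bp (simF t A B) Q).
  refine (macro_move (H := H) (d := None) _ _ _ _ (h1 _ _)) => //.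
  by rewrite [LHS]/= {1}/B eqxx [LHS]/= getb_getblk // -pE.
have c56 : sreach nocell H (sconf (inr (ReadA s j (Q p))) bp (simF t A B) Q)
    (sconf (inr (ReadA s j (Q p))) p (simF t A B) Q).
  have := @walk_right _ sim_delta O (inr (ReadA s j (Q p))) (simF t A B) Q bp (p - bp) H.
  rewrite subnKC; last by lia.
  apply=> // [i ib|]; last exact: h1.
  rewrite /= {1}/A.
  by have -> : i != p by lia.
have c67 : sreach nocell H (sconf (inr (ReadA s j (Q p))) p (simF t A B) Q)
    (sconf (inr (WriteB s' j ow mv)) p (simF t' A B) Q).
  refine (reachW _ _ (macro_step (H := H) (d := None) (nq := getblk Q p) _ _ _ _ _ (h1 _ _) (h2 _ _))) => //.
  - rewrite /= {1}/A eqxx /=.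
    have -> : (fun i : 'I_3 => nth false [:: t i30 p; t i31 p; t i32 p] i) = (fun i => t i p).
      apply: functional_extensionality => -[[|[|[|//]]] i3] /=; congr (t _ p); exact: val_inj.
    by rewrite dE.
  - apply: functional_extensionality => r; rewrite /simF /t'.
    by case: (r =P p) => [->|_].
  - by rewrite upd_id owrite_id.
have c78 : sreach nocell H (sconf (inr (WriteB s' j ow mv)) p (simF t' A B) Q)
    (sconf (inr (WriteB s' j ow mv)) bp (simF t' A B) Q).
  have := @walk_left _ sim_delta O (fun=> inr (WriteB s' j ow mv)) (simF t' A B) Q p (p - bp) H.
  rewrite subKn; last by lia.
  apply=> // [|i ib|]; [by lia| |exact: h2].
  rewrite /= {1}/B.
  by have -> : p - i != bp by lia.
have c89 : sreach nocell H (sconf (inr (WriteB s' j ow mv)) bp (simF t' A B) Q)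
    (sconf (inr (PutB s' mv)) (p' %/ 7) (simF t' A allT) Q').
  refine (reachW _ _ (macro_step (H := H)
      (d := if mv then (if j == 6 :> nat then Some true else None)
            else (if j == 0 :> nat then Some false else None))
            (nq := setb (getblk Q bp) j ow) _ _ _ _ _ (h2 _ _) (h3 _ _))) => //.
  - by rewrite [LHS]/= {1}/B eqxx.
  - apply: functional_extensionality => r; rewrite /simF /B /allT.
    by case: (r =P bp) => [->|_].
  - by rewrite upd_setb // -pE.
  - rewrite /p'; case: (mv); case: eqP => ej /=; lia.
have c910 : sreach (ones (btape (simF t' A allT)) Q') H
    (sconf (inr (PutB s' mv)) (p' %/ 7) (simF t' A allT) Q')
    (sconf (inr (LiftA s' mv)) (p' %/ 7) (simF t' A (fun r => r != p' %/ 7)) Q').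
  refine (macro_step (H := H) (d := None) (nq := getblk Q' (p' %/ 7)) _ _ _ _ _ (h3 _ _) (h3 _ _)) => //.
  - apply: functional_extensionality => r; rewrite /simF /allT.
    by case: (r =P (p' %/ 7)) => [->|_].
  - by rewrite upd_id owrite_id.
(* The mark in track [a] is still at [p], and [p' %/ 7 <= p], so it is found by walking right. *)
have c1011 : sreach nocell H
    (sconf (inr (LiftA s' mv)) (p' %/ 7) (simF t' A (fun r => r != p' %/ 7)) Q')
    (sconf (inr (LiftA s' mv)) p (simF t' A (fun r => r != p' %/ 7)) Q').
  have := @walk_right _ sim_delta O (inr (LiftA s' mv)) (simF t' A (fun r => r != p' %/ 7)) Q'
    (p' %/ 7) (p - p' %/ 7) H.
  rewrite subnKC; last by rewrite /p'; case: (mv); lia.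
  apply=> // [i ib|]; last exact: h3.
  rewrite /= {1}/A.
  by have -> : i != p by lia.
have c1112 : sreach nocell H
    (sconf (inr (LiftA s' mv)) p (simF t' A (fun r => r != p' %/ 7)) Q')
    (sconf (inr (PutA s')) p' (simF t' allT (fun r => r != p' %/ 7)) Q').
  refine (reachW _ _ (macro_step (H := H) (d := Some mv) (nq := getblk Q' p) _ _ _ _ _ (h3 _ _) (h3 _ _))) => //.
  - by rewrite /= {1}/A eqxx.
  - apply: functional_extensionality => r; rewrite /simF /A /allT.
    by case: (r =P p) => [->|_].
  - by rewrite upd_id owrite_id.
have c1213 : sreach (ones (btape (simF t' allT (fun r => r != p' %/ 7))) Q') H
    (sconf (inr (PutA s')) p' (simF t' allT (fun r => r != p' %/ 7)) Q') (simconf g').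
  rewrite /simconf g'E.
  refine (macro_step (H := H) (d := None) (nq := getblk Q' p') _ _ _ _ _ (h3 _ _) (h3 _ _)) => //.
  - apply: functional_extensionality => r; rewrite /simF /allT /=.
    by case: (r =P p') => [->|_].
  - by rewrite upd_id owrite_id.
have r1 := reach_transr c01 (reach_transr c12 c23).
have r2 := reach_transl r1 (reach_transl c34 (reach_transl c45 (reach_transl c56
             (reach_transl c67 (reach_transl c78 c89))))).
have r3 := reach_trans r2 (reach_transl c910 (reach_transl c1011 c1112)).
(* Three snapshots cover [full g]: the tape before the step gives all but the two marked cells, the
   tape with the mark [b] lifted gives track [b], and the one with the mark [a] lifted gives track
   [a]. *)
apply: reachW (reach_trans r3 c1213) => // -[[] m]; last by move=> h; left; left.
rewrite /full /ones /btape /=.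
have : m %% 7 < 7 by rewrite ltn_pmod.
case: (m %% 7) => [|[|[|[|[|[|[|//]]]]]]] /= _ h; do ?by left; left.
- by right.
- by left; right.
Qed.

End Step.

Lemma sim_step g b : (cst g : nat) <> 1 -> (cst g : nat) <> 3 ->
  sreach (full g) (fun z => full g z \/ full (step P O b g) z) (simconf g) (simconf (step P O b g)).
Proof.
move=> n1 n3.
case dE: (delta P (cst g) (fun i => ctapes g i (chead g)) (cotape g (chead g))) => [[[s' w] ow] mv].
exact: sim_step_aux dE.
Qed.

(** A query is a single machine step that lifts no mark. Its lower bound is only the [h] cell of
    block 0, enough to certify a nonempty run. *)
Lemma sim_query g b : (cst g : nat) = 3 -> orc_ans O (cotape g) b ->
  sreach (eq (true, 2)) (full g) (simconf g) (simconf (step P O b g)).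
Proof.
move=> s3 ob; rewrite /step s3 /= /simconf /=.
have -> : sim_state (cst g) = inl q_query by rewrite /sim_state s3.
have -> : sim_state (inord (if b then 4 else 5)) = inl (if b then q_yes else q_no).
  by rewrite /sim_state inordK; case: b ob => // _; lia.
have r := mconf_query (micro_delta sim_delta) (7 * chead g)
  (btape (simF (ctapes g) (fun r => r != chead g) (fun r => r != chead g %/ 7))) ob.
refine (reachW _ _ (reach_run r)); first by move=> z <-.
by move=> [[] m]; rewrite /full /ones //=; apply: btape_simF_full.
Qed.

Lemma lconf_simconf g : (cst g : nat) = 2 -> chead g = 0 ->
  sreach nocell (full g) (lconf g) (simconf g).
Proof.
move=> s2 h0; rewrite /lconf /simconf h0.
have -> : sim_state (cst g) = inr (CountLeft (inord 2) ord0).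
  rewrite /sim_state s2; congr (inr (CountLeft _ _)).
  by apply: val_inj; rewrite /= s2 inordK //; lia.
refine (reachW _ _ (macro_step (H := full g) (d := None) (nq := getblk (cotape g) 0) _ _ _ _ _ _ _)) => //.
- apply: functional_extensionality => r; rewrite /simF /allT.
  by case: (r =P 0) => [->|].
- by rewrite upd_id owrite_id.
- by move=> [[] m]; rewrite /full /ones //=; apply: btape_simF_full.
Qed.

(** The tracks [g], [h], [a], [b] are the same in all [full] tapes; the remaining cells follow the
    limit rule of the simulated machine. *)
Lemma full_limit I (lt : I -> I -> Prop) (f : I -> config 3 (nst P)) i j z :
  lt i j -> wellorder lt -> is_limit lt f j (f j) ->
  full (f j) z <-> (forall i, lt i j -> exists i', ~ lt i' i /\ lt i' j /\ full (f i') z).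
Proof.
move=> ij wo [_ [_ [lw lo]]].
case: z => [[] m]; rewrite /full /ones /=; last exact: lo.
rewrite /btape; have : m %% 7 < 7 by rewrite ltn_pmod.
case: (m %% 7) => [|[|[|[|[|[|[|//]]]]]]] /= _; try exact: lw.
all: split=> [h l lj|]; [exists l; split=> //; exact: (wo_irrefl (wo_wf wo))|].
all: by move=> /(_ _ ij) [i' [_ [_]]].
Qed.

End Simulation.

(** * Simulation along a well-order *)

Section Transfer.
Variables (P : prog 3) (O : oracle).
Notation sim_prog := (macro_prog (@sim_delta P)).
Notation sreach := (@reach sim_prog O).
Notation sconf := (bconf (@sim_delta P)).

Section Transfinite.
Variables (I : Type) (lt : I -> I -> Prop) (f : I -> config 3 (nst P)) (ih : I).
Hypothesis ltW : wellorder lt.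
Hypothesis succ_rule : forall i j, lt i j -> (forall l, ~ (lt i l /\ lt l j)) ->
  (cst (f i) : nat) <> 1 /\ exists b, orc_ans O (cotape (f i)) b /\ f j = step P O b (f i).
Hypothesis limit_rule : forall j, (exists i, lt i j) ->
  (forall i, lt i j -> exists l, lt i l /\ lt l j) -> is_limit lt f j (f j).
Hypothesis halted : (cst (f ih) : nat) = 1.

Let K := {i : I | lt i ih}.
Let ltK (k k' : K) := lt (proj1_sig k) (proj1_sig k').

Let ltK_wo : wellorder ltK.
Proof.
split.
- exact: wf_inverse_image (wo_wf ltW).
- by move=> i j l; apply: (wo_trans ltW).
- move=> [i hi] [j hj]; rewrite /ltK /=; case: (wo_total ltW i j) => [h|[h|h]].
  + by left.
  + by right; left; subst j; rewrite (proof_irrelevance _ hi hj).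
  + by right; right.
Qed.

Let is_succ i j := lt i j /\ forall l, ~ (lt i l /\ lt l j).

Let succ_uniq i j j' : is_succ i j -> is_succ i j' -> j = j'.
Proof.
move=> [ij n] [ij' n']; case: (wo_total ltW j j') => [h|[//|h]].
  by case: (n' j).
by case: (n j').
Qed.

Let succ_ex (k : K) : exists j, is_succ (proj1_sig k) j.
Proof.
case: k => [i hi]; have [|m [im mm]] := wo_min (A := lt i) (wo_wf ltW); first by exists ih.
by exists m; split=> // l [il /mm].
Qed.

Let is_lim j := (exists i, lt i j) /\ forall i, lt i j -> exists l, lt i l /\ lt l j.

Let not_lim j : (exists i, lt i j) -> ~ is_lim j -> exists i, is_succ i j.
Proof.
move=> ex nl; apply: NNPP => no; apply: nl; split=> // i ij; apply: NNPP => no'.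
by apply: no; exists i; split=> // l il; apply: no'; exists l.
Qed.

(* At a limit the simulating machine still has to set the marks. *)
Let start (j : I) : config 1 (nst sim_prog) :=
  if excluded_middle_informative (is_lim j) then lconf (f j) else simconf (f j).

Let start_lim j : is_lim j -> start j = lconf (f j).
Proof. by rewrite /start; destruct (excluded_middle_informative (is_lim j)). Qed.

Let start_nlim j : ~ is_lim j -> start j = simconf (f j).
Proof. by rewrite /start; destruct (excluded_middle_informative (is_lim j)). Qed.

Let full2 g : @full P g (true, 2).
Proof. by []. Qed.

(** The piece simulating stage [i]. The lower bound excludes query stages, whose marks stay down. *)
Let segment i j : is_succ i j -> exists U, [/\ run O U (start i) (simconf (f j)),
  (cst (f i) : nat) <> 3 -> forall z, full (f i) z -> U z &
  forall z, U z -> full (f i) z \/ full (f j) z].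
Proof.
move=> [ij nb]; have [n1 [b [ob fj]]] := succ_rule ij nb.
have sl (H : cell -> Prop) : (forall z, full (f i) z -> H z) -> sreach nocell H (start i) (simconf (f i)).
  move=> sH; case: (classic (is_lim i)) => [lim|/start_nlim ->]; last exact: reach_refl.
  rewrite start_lim //; case: lim => e d; have [s2 [h0 _]] := limit_rule e d.
  by apply: reachW (lconf_simconf O s2 h0).
have sH z : full (f i) z -> full (f i) z \/ full (step P O b (f i)) z by left.
rewrite fj; case: (eqVneq (cst (f i) : nat) 3) => [e3|/eqP n3].
  have r := reachW (fun z h => h) sH (sim_query e3 ob).
  by have [U [rU _ uU]] := reach_inv (reach_transr (sl _ sH) r) (erefl (true, 2)); exists U.
have r := sim_step O b n1 n3.
by have [U [rU lU uU]] := reach_inv (reach_transr (sl _ sH) r) (full2 (f i)); exists U.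
Qed.

(** The limsup over the pieces is compared with the limsup of the [full] tapes; a discrepancy within
    one piece is absorbed by passing to the next stage, which is still below the limit. *)
Let limit_start j (c : K -> cell -> Prop) (sc : K -> I) : is_lim j -> lt j ih ->
  (forall k, is_succ (proj1_sig k) (sc k)) ->
  (forall k : K, (cst (f (proj1_sig k)) : nat) <> 3 -> forall z, full (f (proj1_sig k)) z -> c k z) ->
  (forall k z, c k z -> full (f (proj1_sig k)) z \/ full (f (sc k)) z) ->
  limit_of ltK (fun k => lt (proj1_sig k) j) c (start j).
Proof.
move=> lj jih scP lo up.
rewrite start_lim //; case: (lj) => [[i0 i0j] dense].
split; first exact: state_code_inl.
split; first by rewrite /= muln0.
move=> z.
have -> : (cellv (lconf (f j)) z : Prop) = full (f j) z.
  by rewrite /full /ones /cellv; case: (z.1).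
have fl := full_limit z i0j ltW (limit_rule (ex_intro _ i0 i0j) dense).
have sub i : lt i j -> lt i ih by move=> h; apply: (wo_trans ltW h jih).
have scj k : lt (proj1_sig k) j -> lt (sc k) j.
  move=> kj; have [l [kl lj']] := dense _ kj; have [ks nb] := scP k.
  case: (wo_total ltW (sc k) l) => [h|[->//|h]]; first exact: (wo_trans ltW h).
  by case: (nb l).
split.
  move=> /fl h [i ii] /= ij; have [i' [ni [i'j Vi]]] := h _ ij.
  pose k' : K := exist _ i' (sub _ i'j).
  case: (eqVneq (cst (f i') : nat) 3) => [e3|/eqP n3]; last first.
    by exists k'; split=> //; split=> //; apply: lo.
  (* The stage after a query has the same tapes and an answer state, so its piece does satisfy the
     lower bound. *)
  have sj := scj k' i'j; pose k2 : K := exist _ (sc k') (sub _ sj).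
  have [i's nb] := scP k'.
  exists k2; split.
    move=> si; apply: ni; exact: (wo_trans ltW i's si).
  split=> //; have [_ [b [ob fs]]] := succ_rule i's nb.
  apply: lo; rewrite /= fs /step e3 /=; last by [].
  by case: (b); rewrite inordK //; lia.
move=> h; apply/fl => i ij; have [[i' i'h] /= [ni [i'j /up Vi]]] := h (exist _ i (sub _ ij)) ij.
case: Vi => /= Vi; first by exists i'.
(* A cell coming from the tape of the next stage is charged to that stage. *)
have [i's _] := scP (exist _ i' i'h); exists (sc (exist _ i' i'h)).
split; last by split=> //; apply: scj.
case: (wo_total ltW i i') => [hi|[e|/ni//]] si; apply: (wo_irrefl (wo_wf ltW) (i := i)).
  exact: (wo_trans ltW hi (wo_trans ltW i's si)).
by rewrite {1}e; exact: (wo_trans ltW i's si).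
Qed.

(** The pieces of all stages before [ih] are concatenated. The stage [ih] is no limit, its state
    being 1 rather than 2, so the run ends in [simconf] and not in [lconf]. *)
Lemma sim_transfinite i0 : (forall i, ~ lt i i0) ->
  (forall j, ~ lt ih j) -> sreach nocell (fun=> True) (simconf (f i0)) (simconf (f ih)).
Proof.
move=> i0min ihmax.
case: (wo_total ltW i0 ih) => [i0ih|[->|/i0min//]]; last exact: reach_refl.
have [sc scP] := fun_choice succ_ex.
have [U UP] := fun_choice (fun k => segment (scP k)).
have nlih : ~ is_lim ih.
  by move=> [e d]; have [s2 _] := limit_rule e d; move: halted; rewrite s2.
have nl0 : ~ is_lim i0 by move=> [[i /i0min]].
have succ_case j : (exists i, lt i j) -> ~ is_lim j -> lt j ih \/ j = ih ->
    continues ltK (fun k => lt (proj1_sig k) j) (fun m c' => c' = simconf (f (sc m))) U (simconf (f j)).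
  move=> ex nl jih; have [i [ij nb]] := not_lim ex nl.
  have iih : lt i ih by case: jih => [h|<-//]; apply: (wo_trans ltW ij h).
  left; exists (exist _ i iih); split=> //; split=> [[l lh] /= lj il|].
    by case: (nb l).
  by congr (simconf (f _)); apply: succ_uniq (scP _).
have r : run O (fun z => exists k, U k z) (start i0) (simconf (f ih)).
  apply: (run_sum (lt := ltK) (c := fun k => start (proj1_sig k))
            (d := fun k => simconf (f (sc k))) (k0 := exist _ i0 i0ih)) => //.
  - by move=> k; case: (UP k).
  - by move=> [k hk]; apply: i0min.
  - move=> [j jh] [[i ii] ij]; rewrite /ltK /= in ij *.
    case: (classic (is_lim j)) => lj.
      right; split; first by exists (exist _ i ii).
      split.
        move=> [k kh] /= kj; case: lj => _ /(_ _ kj) [l [kl lj]].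
        by exists (exist _ l (wo_trans ltW lj jh)).
      by apply: (limit_start lj jh scP) => k; case: (UP k).
    by rewrite start_nlim //; apply: succ_case => //; [exists i|left].
  - apply: eq_next (succ_case ih _ _ _) => //; last by right.
      by move=> [k kh].
    by exists i0.
rewrite -start_nlim //; exact: reachW (reach_run r).
Qed.

End Transfinite.

End Transfer.

(** * Stretching the input and erasing the tape *)

Section InputOutput.
Variables (P : prog 3) (O : oracle).
Notation S := ('I_(nst P + 5).+1).
Notation sim_prog := (macro_prog (@sim_delta P)).
Notation sreach := (@reach sim_prog O).
Notation sconf := (bconf (@sim_delta P)).

Definition done_blk (x : real) (r : nat) : blk :=
  (r != 0, x r, true, false, false, r != 0, r != 0).

(* The tape after [n] rounds: [n] finished blocks, a 0 marking the frontier, and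
   the remaining input bits [x n, x n.+1, ...] *)
Definition stretch (x : real) (n : nat) : real :=
  fun m => if m < 7 * n then btape (done_blk x) m
           else if m == 7 * n then false else x (m - 6 * n - 1).

Lemma stretch_done x n r : r < n -> getblk (stretch x n) r = done_blk x r.
Proof.
move=> rn; apply: eq_blk => i i7; rewrite getb_getblk // /stretch.
have -> : 7 * r + i < 7 * n by lia.
exact: btapeE.
Qed.

Lemma stretch_raw x n m : 7 * n < m -> stretch x n m = x (m - 6 * n - 1).
Proof.
move=> nm; rewrite /stretch.
have -> : m < 7 * n = false by lia.
by have -> : (m == 7 * n) = false by lia.
Qed.

Lemma stretch_next x n i : stretch x n (7 * n + i.+1) = x (n + i).
Proof. by rewrite stretch_raw; [congr (x _)|]; lia. Qed.

Lemma stretch_mark x n : stretch x n (7 * n) = false.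
Proof. by rewrite /stretch ltnn eqxx. Qed.

Lemma delta_shift7 q r rq :
  sim_delta (P := P) (inr (Shift7 q)) r rq = (inr (Shift7 r), q, rq, Some true).
Proof. by case: r => [[[[[[? ?] ?] ?] ?] ?] ?]. Qed.

Definition head6 (b : blk) : blk6 :=
  let: (b0, b1, b2, b3, b4, b5, _) := b in (b0, b1, b2, b3, b4, b5).

(** A shift by six cells: a new block consists of six carried bits followed by the first cell of the
    old block. *)
Lemma delta_shift6 F F' r rq : getb (F' r) 6 = getb (F r) 0 ->
  (forall i, i < 6 -> getb (F' r.+1) i = getb (F r) i.+1) ->
  sim_delta (P := P) (inr (Shift6 (head6 (F' r)))) (F r) rq =
    (inr (Shift6 (head6 (F' r.+1))), F' r, rq, Some true).
Proof.
case: (F r) (F' r) (F' r.+1) => [[[[[[a0 a1] a2] a3] a4] a5] a6]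
  [[[[[[b0 b1] b2] b3] b4] b5] b6] [[[[[[c0 c1] c2] c3] c4] c5] c6] /= -> h.
by move: (h 0 isT) (h 1 isT) (h 2 isT) (h 3 isT) (h 4 isT) (h 5 isT) => /= -> -> -> -> -> ->.
Qed.

Lemma first_round x Q : sreach nocell (fun=> True)
  (sconf (inl q_start) 0 (getblk x) Q) (sconf (inl q_limit) 0 (getblk (stretch x 1)) Q).
Proof.
pose s r : 'I_6 + sim S :=
  if r == 0 then inl q_start else inr (Shift7 (getblk (stretch x 1) r)).
apply: (sweep (q := 0) O (s := s)) => //.
  by case.
case=> [_|r _]; first by [].
apply: etrans (delta_shift7 _ _ _) _; congr (inr (Shift7 _), _, _, _).
apply: eq_blk => i i7; rewrite !getb_getblk // stretch_raw; last by lia.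
by congr (x _); lia.
Qed.

(** The cell [(true, 5)] is the [a] cell of block 0, flashed in every round. All other cells that
    become 1 are already 1 on the tape at one end of the round. *)
Lemma next_round x Q n : 0 < n -> sreach (eq (true, 5))
  (fun z => ones (stretch x n) Q z \/ ones (stretch x n.+1) Q z \/ z = (true, 5))
  (sconf (inl q_limit) 0 (getblk (stretch x n)) Q)
  (sconf (inl q_limit) 0 (getblk (stretch x n.+1)) Q).
Proof.
move=> n0; set H := fun z => _.
pose F1 r := if r == 0 then (false, x 0, true, false, false, true, false)
             else getblk (stretch x n) r.
have hn z : ones (btape (getblk (stretch x n))) Q z -> H z.
  by rewrite btape_getblk; left.
have h1 z : ones (btape F1) Q z -> H z.
  case: z => -[] m; last by left.
  rewrite /ones /= => hm; case: (eqVneq m 5) => [->|m5]; first by right; right.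
  left; rewrite /ones /= -[stretch x n]btape_getblk.
  move: hm; rewrite /btape /F1; case: eqP => // m0; rewrite m0 stretch_done //.
  have : m %% 7 != 5 by lia.
  by case: (m %% 7) => [|[|[|[|[|[|[|m']]]]]]].
have c1 : sreach nocell H (sconf (inl q_limit) 0 (getblk (stretch x n)) Q)
    (sconf (inr Flash) 0 F1 Q).
  refine (reachW _ _ (macro_step (H := H) (d := None) (nq := getblk Q 0) _ _ _ _ _ hn h1)) => //.
  - by rewrite stretch_done.
  - by rewrite upd_id owrite_id.
have c2 : sreach (ones (btape F1) Q) H (sconf (inr Flash) 0 F1 Q)
    (sconf (inr Frontier) 1 (getblk (stretch x n)) Q).
  refine (macro_step (H := H) (d := Some true) (nq := getblk Q 0) _ _ _ _ _ h1 hn) => //.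
  - apply: functional_extensionality => r; rewrite /F1; case: (r =P 0) => [->|//].
    by rewrite stretch_done.
  - by rewrite upd_id owrite_id.
have c3 : sreach nocell H (sconf (inr Frontier) 1 (getblk (stretch x n)) Q)
    (sconf (inr Frontier) n (getblk (stretch x n)) Q).
  have := @walk_right _ (@sim_delta P) O (inr Frontier) (getblk (stretch x n)) Q 1 n.-1 H.
  rewrite add1n prednK //; apply=> // i ib.
  rewrite stretch_done /=; last by lia.
  by have -> : i != 0 by lia.
have c4 : sreach nocell H (sconf (inr Frontier) n (getblk (stretch x n)) Q)
    (sconf (inl q_limit) 0 (getblk (stretch x n.+1)) Q).
  pose s r : 'I_6 + sim S :=
    if r == n then inr Frontier else inr (Shift6 (head6 (getblk (stretch x n.+1) r))).
  have -> : inr Frontier = s n by rewrite /s eqxx.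
  apply: sweep hn _ => //.
  - by move=> r _; rewrite /s; case: eqP.
  - by move=> r rn; rewrite !stretch_done //; lia.
  - move=> r nr; rewrite /s; case: (eqVneq r n) => [->|rn]; last first.
      have -> : (r.+1 == n) = false by lia.
      apply: (delta_shift6 (F := getblk (stretch x n)) (F' := getblk (stretch x n.+1))) => [|i i6].
        rewrite !getb_getblk // !stretch_raw; [|by lia..].
        by congr (x _); lia.
      rewrite !getb_getblk ?(ltn_trans i6) // !stretch_raw; [|by lia..].
      by congr (x _); lia.
    have -> : (n.+1 == n) = false by lia.
    rewrite [getblk (stretch x n.+1) n]stretch_done // /done_blk.
    have -> : n != 0 by lia.
    rewrite /getblk /mkb /head6 !addn0 !stretch_mark !stretch_next !addSnnS [n + 0]addn0.
    by [].
  - by rewrite btape_getblk => z h; right; left.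
apply: reachW (reach_transr c1 (reach_transl c2 (reach_transl c3 c4))) => // z <-.
by [].
Qed.

(** The tape at stage [omega ^ 2]: it differs from [done_blk] only in the flashed [a] cell of block
    0. *)
Definition ready (x : real) (r : nat) : blk := (r != 0, x r, true, false, false, true, r != 0).

(** Every cell but [(true, 5)] is constant once the frontier has passed it, and [(true, 5)] is 1 in
    every round. *)
Lemma all_rounds x Q : sreach nocell (fun=> True)
  (sconf (inl q_limit) 0 (getblk (stretch x 1)) Q) (sconf (inl q_limit) 0 (ready x) Q).
Proof.
have st n := reach_inv (next_round x Q (ltn0Sn n)) (erefl (true, 5)).
have [U UP] := fun_choice st.
have ev n m : m < 7 * n -> m != 5 -> stretch x n m = btape (ready x) m.
  move=> mn m5; rewrite /stretch mn /btape /done_blk /ready.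
  case: (eqVneq (m %/ 7) 0) => [m0|//].
  have : m %% 7 != 5 by lia.
  by case: (m %% 7) => [|[|[|[|[|[|[|m']]]]]]].
have r : run O (fun z => exists n, U n z) (sconf (inl q_limit) 0 (getblk (stretch x 1)) Q)
    (sconf (inl q_limit) 0 (ready x) Q).
  apply: (run_omega (c := fun n => sconf (inl q_limit) 0 (getblk (stretch x n.+1)) Q)).
  - by move=> n; case: (UP n).
  - exact: state_code_inl.
  - by rewrite /= muln0.
  move=> z; have -> : (cellv (sconf (inl q_limit) 0 (ready x) Q) z : Prop) = ones (btape (ready x)) Q z.
    by rewrite /ones /cellv; case: (z.1).
  have lo n : ones (stretch x n.+1) Q z -> U n z.
    move=> h; case: (UP n) => r _ _; apply: run_start r _.
    by move: h; rewrite /ones /cellv /= btape_getblk; case: (z.1).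
  case: (z =P (true, 5)) => [z5|nz].
    split=> [_ n|_]; last by rewrite z5.
    by exists n; split=> //; case: (UP n) => _ h _; apply: h.
  have evz n : z.2 < 7 * n -> ones (stretch x n) Q z <-> ones (btape (ready x)) Q z.
    case: z nz {lo} => -[] m nz; rewrite /ones //= => mn; rewrite ev //.
    by apply/eqP => m5; apply: nz; rewrite m5.
  split=> [h n|/(_ z.2) [m [nm Um]]].
    exists (maxn n z.2); split; first by lia.
    by apply: lo; apply/evz => //; lia.
  by case: (UP m) => _ _ /(_ z Um) [|[|//]] /evz; apply; lia.
exact: reachW (reach_run r).
Qed.

(** In [ready x] the [b] cell of block 0 is already 0; clearing its [a] cell yields exactly the
    marks of a simulated head at cell 0. *)
Lemma input_phase x :
  sreach nocell (fun=> True) (init sim_prog O ord0 x) (simconf (init P O (inord 0) x)).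
Proof.
set Q := match O with OReal b => b | OSet _ => fun=> false end.
have -> : init sim_prog O ord0 x = sconf (inl q_start) 0 (getblk x) Q.
  rewrite /init /bconf /mconf btape_getblk muln0; congr Config.
  by apply: functional_extensionality => t; rewrite (ord1 t).
apply: reach_transl (first_round x Q) _.
apply: reach_transl (all_rounds x Q) _.
have -> : simconf (init P O (inord 0) x) =
    sconf (inr (CountLeft (inord 0) ord0)) 0
      (fun r => if r == 0 then (false, x 0, true, false, false, false, false) else ready x r) Q.
  rewrite /simconf /= /sim_state inordK //; congr bconf.
  have e0 : i30 = inord 0 by apply: val_inj; rewrite /= inordK.
  have e1 : (i31 == inord 0) = false by rewrite -val_eqE /= inordK.
  have e2 : (i32 == inord 0) = false by rewrite -val_eqE /= inordK.
  apply: functional_extensionality => r; rewrite /simF /ready e0 eqxx e1 e2.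
  by case: (eqVneq r 0) => [->|r0]; rewrite /= ?div0n ?eqxx ?(negPf r0).
refine (reachW _ _ (macro_step (H := fun=> True) (d := None) (nq := getblk Q 0) _ _ _ _ _ _ _)) => //.
by rewrite upd_id owrite_id.
Qed.

(** The halt state is carried to block 0 by the usual walk. One sweep then leaves only the output
    bit, and the limit that follows finds [h = 0]. *)
Lemma output_phase (cf : config 3 (nst P)) b : (cst cf : nat) = 1 -> ctapes cf (inord 2) = enc b ->
  sreach nocell (fun=> True) (simconf cf) (sconf (inl q_halt) 0 (getblk (enc b)) (cotape cf)).
Proof.
move=> s1 out.
set F := simF (ctapes cf) (fun r => r != chead cf) (fun r => r != chead cf %/ 7).
set s := cst cf; set Q := cotape cf; set p := chead cf.
have c1 : sreach nocell (fun=> True) (simconf cf) (sconf (inr (CountLeft s (inord (p %% 7)))) 0 F Q).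
  have := @walk_left _ (@sim_delta P) O (fun i => inr (CountLeft s (inord (i %% 7)))) F Q p p (fun=> True).
  rewrite subnn (_ : inord (0 %% 7) = ord0); last by apply: val_inj; rewrite /= inordK.
  rewrite /simconf -/F -/Q -/p /sim_state s1; apply=> // i ip.
  rewrite /= subn_eq0 leqNgt ip /= inordK ?ltn_pmod //.
  by have -> : (i %% 7).+1 %% 7 = i.+1 %% 7 by lia.
apply: reach_transl c1 _.
pose st r : 'I_6 + sim S := if r == 0 then inr (CountLeft s (inord (p %% 7))) else inr Erase.
have c2 : sreach nocell (fun=> True) (sconf (st 0) 0 F Q) (sconf (inl q_limit) 0 (getblk (enc b)) Q).
  apply: sweep => //; first by move=> r _; rewrite /st; case: eqP.
  case=> [|r] _ //=; rewrite /s s1 /=.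
  have -> : ctapes cf i32 = enc b.
    by rewrite -out; congr (ctapes cf _); apply: val_inj; rewrite /= inordK.
  by [].
apply: reach_transl c2 _.
exact: (macro_move O (H := fun=> True) (d := None)).
Qed.

Lemma sim_halts x cf b : halts_from P O (init P O (inord 0) x) cf -> ctapes cf (inord 2) = enc b ->
  exists cf', halts_from sim_prog O (init sim_prog O ord0 x) cf' /\ ctapes cf' ord0 = enc b.
Proof.
move=> [I [lt [f [wf [tr [tot [[i0 [i0min fi0]] [succ_r [lim_r [ih [s1 [ihmax fih]]]]]]]]]]]] out.
exists (sconf (inl q_halt) 0 (getblk (enc b)) (cotape cf)); split; last exact: btape_getblk.
rewrite fih in s1.
have r := reach_transl (input_phase x) (reach_transl _ (output_phase s1 out)).
case: r => [|[e _]|[U [r _ _]]].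
- rewrite -fi0 -fih; apply: (sim_transfinite (lt := lt)) => //.
  by rewrite fih.
(* The start and halt states differ, so the computation is not trivial. *)
- move/(congr1 (fun c => cst c : nat)): e.
  by rewrite [X in _ = X]state_code_inl /= inordK.
- by apply: run_halts r _; exact: state_code_inl.
Qed.

End InputOutput.

(** * From one tape to three *)

Section OneToThree.
Variables (P : prog 1) (O : oracle).

(* Every write goes to all three tapes, so the output tape agrees with the
   simulated tape on the visited cells and is blank elsewhere. *)
Definition triple_prog : prog 3 :=
  @Prog 3 (nst P) (fun s r o =>
    let: (s', w, ow, mv) := delta P s (fun=> r (inord 0)) o in (s', fun=> w ord0, ow, mv)).

Lemma triple_halts x cf b : halts_from P O (init P O ord0 x) cf -> ctapes cf ord0 = enc b ->
  exists cf', halts_from triple_prog O (init triple_prog O (inord 0) x) cf' /\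
    ctapes cf' (inord 2) = enc b.
Proof.
move=> [I [lt [f [wf [tr [tot [[i0 [i0min fi0]] [succ_r [lim_r [ih [s1 [ihmax fih]]]]]]]]]]]] out.
(* A query step writes nothing and does not count as a visit. *)
pose visited i m := exists i', lt i' i /\ chead (f i') = m /\ (cst (f i') : nat) <> 3.
have [v vP] : exists v : I * nat -> bool, forall im, v im <-> visited im.1 im.2.
  apply: (fun_choice (R := fun im (b : bool) => b <-> visited im.1 im.2)) => -[i m].
  by case: (classic (visited i m)) => h; [exists true|exists false].
(* The input tape copies the simulated tape; the other two tapes show it on the visited cells
   only. *)
pose f' i : config 3 (nst triple_prog) := Config (cst (f i) : 'I_(nst triple_prog + 5).+1) (chead (f i))
  (fun t m => ctapes (f i) ord0 m && ((t == inord 0) || v (i, m))) (cotape (f i)).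
have between i j : lt i j -> (forall l, ~ (lt i l /\ lt l j)) -> forall l, lt l j -> lt l i \/ l = i.
  by move=> ij nb l lj; case: (tot l i) => [h|[h|h]]; [left|right|case: (nb l)].
have i0ih : lt i0 ih.
  case: (tot i0 ih) => [//|[e|/i0min//]].
  by move: s1; rewrite -e fi0 /= inordK.
exists (f' ih); split.
  exists I, lt, f'; do 3 split=> //; split.
    exists i0; split=> //; rewrite /f' fi0 /init; congr Config.
    apply: functional_extensionality => t; apply: functional_extensionality => m /=.
    case: eqP => [_|_] /=; first by rewrite andbT.
    by apply/andP => -[_ /vP [i' [/i0min]]].
  split.
    move=> i j ij nb; have [n1 [a [oa fj]]] := succ_r i j ij nb.
    split=> //; exists a; split=> //.
    have sub := between _ _ ij nb.
    have vkeep m : (cst (f i) : nat) = 3 \/ chead (f i) <> m -> v (j, m) = v (i, m).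
      move=> cond; apply/idP/idP => /vP /= [i' [h1 [h2 h3]]]; apply/vP.
        have [h|h] := sub _ h1; first by exists i'.
        by subst i'; case: cond.
      by exists i'; split=> //; apply: tr h1 ij.
    rewrite /f' fj /step /=; case: eqP => [e3|n3].
      congr Config; apply: functional_extensionality => t; apply: functional_extensionality => m.
      by rewrite vkeep //; left.
    rewrite eqxx orTb andbT.
    have -> : (fun i1 : 'I_1 => ctapes (f i) i1 (chead (f i))) = (fun=> ctapes (f i) ord0 (chead (f i))).
      by apply: functional_extensionality => t; rewrite (ord1 t).
    case: (delta P _ _ _) => [[[s' w] ow] mv] /=.
    congr Config; apply: functional_extensionality => t; apply: functional_extensionality => m.
    case: eqP => [->|nm]; last by rewrite vkeep //; right=> e; apply: nm.
    suff -> : v (j, chead (f i)) by rewrite orbT andbT.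
    by apply/vP; exists i.
  split; last by exists ih.
  move=> j exj dense; have [s2 [h0 [lt_ lo]]] := lim_r j exj dense.
  split=> //; split=> //; split=> // t m; rewrite /f' /=.
  case: (t == inord 0) => /=.
    by rewrite andbT; apply: (iff_trans (lt_ ord0 m)); split=> h i ij;
      have [i' [a1 [a2 a3]]] := h i ij; exists i'; rewrite ?andbT // in a3 *.
  split.
    move=> /andP [/lt_ h /vP [i1 /= [i1j vi1]]] i ij.
    (* The 1 is sought beyond both [i] and the stage [i2], which follows the visit [i1]; there the
       cell is already visited. *)
    have [i2 [i1i2 i2j]] := dense _ i1j.
    have [k [kj [ik i2k]]] : exists k, lt k j /\ (~ lt k i) /\ (~ lt k i2).
      case: (tot i i2) => [hi|[hi|hi]].
      - exists i2; split=> //; split=> [h'|]; last exact: wo_irrefl.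
        exact: (wo_irrefl wf (tr _ _ _ hi h')).
      - by exists i; split=> //; rewrite -hi; split; apply: wo_irrefl.
      - exists i; split=> //; split=> [|h']; first exact: wo_irrefl.
        exact: (wo_irrefl wf (tr _ _ _ hi h')).
    have [i' [ni' [i'j h']]] := h k kj.
    have trn a1 a2 a3 : ~ lt a1 a2 -> ~ lt a2 a3 -> ~ lt a1 a3.
      move=> q1 q2 q3; case: (tot a1 a2) => [//|[e|h21]]; first by apply: q2; rewrite -e.
      by apply: q2; apply: tr h21 q3.
    exists i'; split; first exact: trn ni' ik.
    split=> //; apply/andP; split=> //; apply/vP; exists i1; split=> //=.
    case: (tot i1 i') => [//|[e|hlt]]; case: (trn _ _ _ ni' i2k); first by rewrite -e.
    exact: tr hlt i1i2.
  move=> h; apply/andP; split.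
    apply/lt_ => i ij; have [i' [a1 [a2 /andP [a3 _]]]] := h i ij.
    by exists i'.
  case: exj => i ij; have [i' [a1 [a2 /andP [_ /vP [i1 /= [a3 a4]]]]]] := h i ij.
  by apply/vP; exists i1; split=> //; apply: tr a3 a2.
apply: functional_extensionality => m; rewrite /f' /= -val_eqE /= !inordK //= fih out.
(* The first stage visits cell 0, so the output tape shows the output bit; [enc b] is blank
   elsewhere. *)
case: (eqVneq m 0) => [->|m0]; last by rewrite /enc (negPf m0).
suff -> : v (ih, 0) by rewrite andbT.
by apply/vP; exists i0; split=> //; rewrite fi0 /= inordK.
Qed.

End OneToThree.

(** * Transfer of computability between the two models *)

Lemma computes_char_transfer k k' (P : prog k) (P' : prog k') ti to ti' to' O A :
  (forall x cf b, halts_from P O (init P O ti x) cf -> ctapes cf to = enc b ->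
     exists cf', halts_from P' O (init P' O ti' x) cf' /\ ctapes cf' to' = enc b) ->
  computes_char P ti to O A -> computes_char P' ti' to' O A.
Proof.
move=> tr; case: A => [a|S] /= h x.
  by have [cf [hc e]] := h x; apply: tr hc e.
have [cf [b [hc [e bS]]]] := h x; have [cf' [hc' e']] := tr _ _ _ hc e.
by exists cf', b.
Qed.

Lemma le_inf1_iff (A B : oracle) : le_inf1 A B <-> le_inf A B.
Proof.
split=> -[P h].
  by exists (triple_prog P); apply: computes_char_transfer h => x cf b; apply: triple_halts.
by exists (macro_prog (@sim_delta P)); apply: computes_char_transfer h => x cf b; apply: sim_halts.
Qed.

Theorem mainTheorem8 :
  (forall A B : oracle, le_inf1 A B <-> le_inf A B) /\
  (forall A B : oracle, eqv_inf1 A B <-> eqv_inf A B).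
Proof.
split=> A B; first exact: le_inf1_iff.
by split=> -[/le_inf1_iff h1 /le_inf1_iff h2].
Qed.
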